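(* Let $F(z)=\sum_{n=0}^N a_n z^n = a_N\prod_{n=1}^N (z-\alpha_n)\in\mathbb{C}[z]$ be a polynomial of degree $N\geq 1$ with complex coefficients $a_0,\ldots,a_N$ and complex roots $\alpha_1,\ldots,\alpha_N$ (listed with multiplicity). If $1\leq p\leq 2$, then $$\|F\|_p \geq B_p\, |a_N| \left( \prod_{n=1}^N \max\{1, |\alpha_n|^p\} + \prod_{n=1}^N \min\{1, |\alpha_n|^p\} \right)^{1/p},$$ and if $p\geq 1$ (with $p$ a real number), then $$\|F\|_p \geq \|F\|_0\left( 1 + \frac{p^2|a_0 a_N|^2}{4\|F\|_0^4}\right)^{1/p}.$$
   Context: Write $e(t)=e^{2\pi i t}$. For a polynomial $f\in\mathbb{C}[z]$ and $0<p<\infty$, $\|f\|_p = \left(\int_0^1 |f(e(t))|^p\,dt\right)^{1/p}$. Mahler's measure of $f$ is $\|f\|_0 = \exp\left(\int_0^1 \log|f(e(t))|\,dt\right)$; for $F$ of degree $N\ge 1$ with leading coefficient $a_N$ and roots $\alpha_1,\ldots,\alpha_N$, Jensen's formula gives $\|F\|_0=|a_N|\prod_{n=1}^N\max\{1,|\alpha_n|\}$. For a positive real number $p$, $$B_p = \left(\frac{1}{2}\int_0^1 |1-e(t)|^p\,dt\right)^{1/p} = \left(\frac{\Gamma(p+1)}{2\,\Gamma(p/2+1)^2}\right)^{1/p}.$$ *)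

(* Defs.v *)
From HB Require Import structures.
From mathcomp Require Import all_boot all_order all_algebra.
From mathcomp Require Import complex.
From mathcomp Require Import all_classical all_reals all_analysis.

Set Implicit Arguments.
Unset Strict Implicit.
Unset Printing Implicit Defensive.

Import Order.TTheory GRing.Theory Num.Theory.
Import numFieldNormedType.Exports.

Local Open Scope classical_set_scope.
Local Open Scope ring_scope.
Local Open Scope complex_scope.

(* The norm `|z| of the library lives in R[i]; this is the same number in R. *)
Definition cabs (R : realType) (z : R[i]) : R := complex.Re `|z|.

(* e(t) = exp (2 pi i t), written in Cartesian form. *)
Definition e (R : realType) (t : R) : R[i] :=
  cos (2 * pi * t) +i* sin (2 * pi * t).

Definition pnorm (R : realType) (p : R) (f : {poly R[i]}) : R :=
  (\int[lebesgue_measure]_(t in `[0, 1]) (cabs f.[e t] `^ p)) `^ p^-1.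

(* The integral is taken in the extended reals, with log 0 = -oo. *)
Definition mahler (R : realType) (f : {poly R[i]}) : R :=
  fine (expeR
    (\int[lebesgue_measure]_(t in `[0%R, 1%R]) lne (cabs f.[e t])%:E)%E).

Definition B (R : realType) (p : R) : R :=
  (2^-1 * \int[lebesgue_measure]_(t in `[0, 1]) (cabs (1 - e t) `^ p)) `^ p^-1.

(* Main.v *)
(**
Reflecting the roots outside the unit disc, [a -> conj a^-1], leaves [|F|]
unchanged on the unit circle up to the factor [M = |a_N| prod max 1 |alpha_n|],
so one may replace [F] by [M * P] with [P(0) = 1] and [x = |P_N| <= 1].
Averaging [P] over the rotations by the [N]-th roots of unity leaves
[1 + P_N z^N]; by convexity the mean of [|P|^p] is at least that of
[|1 + x z|^p].

For [p <= 2], pairing [z] with [-z] and using the concavity of [s^(p/2)] compares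
[|1 + x z|^p] with [(1 + x^p)/2 * |1 + z|^p].  For the second bound, the tangent
line of [exp] at [ln (l * |1 + y z|^2)] bounds the mean of [|1 + x z|^p] from
below by an expression in the means of [ln |1 + x z|] and
[Re z * ln |1 + x z|]; these follow (the second after an integration by parts)
from the factorisation [(1 + x z) (1 - x z) = 1 - x^2 z^2] by iterating
[x -> x^2].  Choosing [y = p x / 2]
when this is at most 1, and [y = 1], [ln l = p x / 2 - 1] otherwise, gives
[1 + (p x / 2)^2].  That [mahler F = M] follows by monotone convergence along
[P (r z)], [r -> 1].
*)

Require Import Defs.
From mathcomp Require Import all_boot all_order all_algebra.
From mathcomp Require Import complex.
From mathcomp Require Import all_classical all_reals all_analysis.
From mathcomp Require Import measurable_realfun.
From mathcomp Require Import ring lra zify.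

Set Implicit Arguments.
Unset Strict Implicit.
Unset Printing Implicit Defensive.

Import Order.TTheory GRing.Theory Num.Theory.
Import numFieldNormedType.Exports.

Local Open Scope classical_set_scope.
Local Open Scope ring_scope.

(** * Means of continuous functions over a period *)

Section Mean.
Context {R : realType}.
Implicit Types h g H : R -> R.
Notation mu := (@lebesgue_measure R).

Definition mean h : R := \int[mu]_(t in `[0, 1]) h t.

Lemma continuous_integrable h (a b : R) : continuous h ->
  mu.-integrable `[a, b] (EFin \o h).
Proof.
move=> ch; apply: continuous_compact_integrable; first exact: segment_compact.
exact: continuous_subspaceT.
Qed.

Lemma eq_mean h g : h =1 g -> mean h = mean g.
Proof. by move=> hg; apply: eq_Rintegral => t _; exact: hg. Qed.

Lemma meanD h g : continuous h -> continuous g ->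
  mean (fun t => h t + g t) = mean h + mean g.
Proof. by move=> ch cg; rewrite /mean RintegralD//; exact: continuous_integrable. Qed.

Lemma meanB h g : continuous h -> continuous g ->
  mean (fun t => h t - g t) = mean h - mean g.
Proof. by move=> ch cg; rewrite /mean RintegralB//; exact: continuous_integrable. Qed.

Lemma meanZ c h : continuous h -> mean (fun t => c * h t) = c * mean h.
Proof. by move=> ch; rewrite /mean RintegralZl//; exact: continuous_integrable. Qed.

Lemma mean_cst (c : R) : mean (fun=> c) = c.
Proof.
rewrite /mean Rintegral_cst// -[RHS]mulr1; congr (_ * _).
have mu01 : mu `[0, 1] = 1%E.
  by rewrite lebesgue_measure_itv/= lte_fin ltr01 oppr0 adde0.
exact: (congr1 fine mu01).
Qed.

Lemma le_mean h g : continuous h -> continuous g ->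
  (forall t, h t <= g t) -> mean h <= mean g.
Proof. by move=> ch cg hg; apply: le_Rintegral => //; exact: continuous_integrable. Qed.

Lemma mean_ge0 h : (forall t, 0 <= h t) -> 0 <= mean h.
Proof. by move=> h0; apply: Rintegral_ge0. Qed.

Lemma continuous_FTC h H (a b : R) : a < b -> continuous h ->
  (forall t : R, a <= t <= b -> is_derive t 1 H (h t)) ->
  \int[mu]_(t in `[a, b]) h t = H b - H a.
Proof.
move=> ab ch dH; rewrite /Rintegral (@continuous_FTC2 _ h H a b)//.
- exact: continuous_subspaceT.
- have cH t : a <= t <= b -> {for t, continuous H}.
    move=> /dH [dHt _]; apply: differentiable_continuous.
    exact/derivable1_diffP.
  split.
  + move=> t; rewrite in_itv/= => /andP[at_ tb].
    by have [] := dH t _; rewrite ?(ltW at_) ?(ltW tb).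
  + by apply: cvg_at_right_filter; apply: cH; rewrite lexx ltW.
  + by apply: cvg_at_left_filter; apply: cH; rewrite lexx ltW.
- move=> t; rewrite in_itv/= => /andP[at_ tb].
  by rewrite derive1E; have [] := dH t _; rewrite ?(ltW at_) ?(ltW tb).
Qed.

Lemma mean_FTC h H : continuous h -> (forall t : R, is_derive t 1 H (h t)) ->
  mean h = H 1 - H 0.
Proof. by move=> ch dH; apply: continuous_FTC => // t _; exact: dH. Qed.

(** The integral needs a finite base point, since a periodic function need not be integrable on a
    half-line; hence a bounded window. *)
Lemma antiderivative_on h (M : R) : continuous h ->
  exists H, forall t : R, - M < t < M -> is_derive t 1 H (h t).
Proof.
move=> ch; exists (fun x => \int[mu]_(t in `[- M, x]) h t) => t /andP[Mt tM].
have [] := @continuous_FTC1_closed R h (- M) t M tM _ Mt (ch t).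
  exact: continuous_integrable.
by rewrite derive1E => dH <-; apply: DeriveDef.
Qed.

Lemma is_derive_affine H (c s t d : R) : is_derive (c * t + s) (1 : R) H d ->
  is_derive t 1 (fun u => H (c * u + s)) (c * d).
Proof.
move=> dH.
have da : is_derive t 1 (fun u : R => c * u + s) c.
  by apply: is_derive_eq; rewrite /GRing.scale/= mulr1 !(mulr0, addr0).
apply: is_derive_eq; exact: mulrC.
Qed.

(** An antiderivative [H] of a periodic [h] grows by [mean h] over every unit interval, so the
    substitution [N t + s] telescopes into [N] equal increments. *)
Lemma mean_affine h (N : nat) (s : R) : continuous h ->
  (forall t, h (t + 1) = h t) -> (0 < N)%N ->
  mean (fun t => h (N%:R * t + s)) = mean h.
Proof.
(* The window of half-width [M] contains every point where [H] is used, with room for shifts by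
   1. *)
move=> ch hP N0; pose M := N%:R + `|s| + 3.
have N1 : 1 <= N%:R :> R by rewrite ler1n.
have s0 : 0 <= `|s| by [].
have [sl sr] : - `|s| <= s /\ s <= `|s| by split; [rewrite lerNl -normrN|]; exact: ler_norm.
have [H dH] := antiderivative_on M ch.
have mh : mean h = H 1 - H 0.
  by apply: continuous_FTC => // t t01; apply: dH; rewrite /M; lra.
(* [H (t + 1) - H t] has derivative [h (t + 1) - h t = 0], so it agrees at [a] and [b]. *)
have step a b : a < b -> - M < a -> b + 1 < M -> H (b + 1) - H b = H (a + 1) - H a.
  move=> ab Ma bM; apply/eqP; rewrite -subr_eq0; apply/eqP.
  have := @continuous_FTC (fun=> 0) (fun t => H (t + 1) - H t) a b ab.
  rewrite Rintegral_cst// mul0r => E; apply/esym/E; first exact: cst_continuous.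
  move=> t abt.
  have d1 : is_derive t (1 : R) (fun t => H (t + 1)) (h t).
    have := @is_derive_affine H 1 1 t (h t).
    rewrite !mul1r; under eq_fun do rewrite mul1r.
    by move=> dd; apply: dd; rewrite -(hP t); apply: dH; lra.
  have d2 : is_derive t (1 : R) H (h t) by apply: dH; lra.
  by apply: is_derive_eq; rewrite subrr.
have per a : - M < a -> a + 1 < M -> H (a + 1) - H a = mean h.
  move=> Ma aM; rewrite mh -{2}(add0r 1).
  have [a0|a0|->//] := ltgtP a 0; last by apply: step => //; rewrite /M; lra.
  by apply/esym/step => //; rewrite /M; lra.
have tele k : (k <= N)%N -> H (s + k%:R) - H s = k%:R * mean h.
  elim: k => [|k IH] kN; first by rewrite addr0 subrr mul0r.
  have kN' : k.+1%:R <= N%:R :> R by rewrite ler_nat.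
  have k0 : 0 <= k%:R :> R by [].
  rewrite -natr1 in kN' *.
  have IHk := IH (ltnW kN).
  have := per (s + k%:R); rewrite -addrA => P.
  have {}P : H (s + (k%:R + 1)) - H (s + k%:R) = mean h by apply: P; rewrite /M; lra.
  lra.
pose K t := N%:R^-1 * H (N%:R * t + s).
transitivity (K 1 - K 0).
  apply: continuous_FTC => // [t|t t01].
    apply: continuous_comp; last exact: ch.
    by apply: cvgD; [apply: cvgM; [exact: cvg_cst|exact: cvg_id]|exact: cvg_cst].
  have d : is_derive t (1 : R) (fun t => H (N%:R * t + s)) (N%:R * h (N%:R * t + s)).
    apply: is_derive_affine; apply: dH.
    have : 0 <= N%:R * t <= N%:R by case/andP: t01 => t0 t1; nra.
    rewrite /M; lra.
  apply: is_derive_eq; rewrite /GRing.scale/=.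
  by rewrite mulKf// pnatr_eq0 -lt0n.
rewrite /K mulr1 mulr0 add0r -mulrBr [N%:R + s]addrC tele//.
by rewrite mulKf// pnatr_eq0 -lt0n.
Qed.

End Mean.

(** * Continuity of composite real functions *)

Section Continuity.
Context {R : realType}.
Implicit Types f g : R -> R.

Lemma cont_cst (c : R) : continuous (fun _ : R => c).
Proof. exact: cst_continuous. Qed.

Lemma eq_cont f g : f =1 g -> continuous g -> continuous f.
Proof. by move=> /funext->. Qed.

Lemma cont_add f g : continuous f -> continuous g ->
  continuous (fun t => f t + g t).
Proof. by move=> cf cg t; apply: cvgD; [exact: cf|exact: cg]. Qed.

Lemma cont_opp f : continuous f -> continuous (fun t => - f t).
Proof. by move=> cf t; apply: cvgN; exact: cf. Qed.

Lemma cont_mul f g : continuous f -> continuous g ->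
  continuous (fun t => f t * g t).
Proof. by move=> cf cg t; apply: cvgM; [exact: cf|exact: cg]. Qed.

Lemma cont_exp f n : continuous f -> continuous (fun t => f t ^+ n).
Proof.
move=> cf; elim: n => [|n IH]; first exact: cont_cst.
by under eq_fun do rewrite exprS; exact: cont_mul.
Qed.

Lemma cont_inv f : continuous f -> (forall t, f t != 0) ->
  continuous (fun t => (f t)^-1).
Proof. by move=> cf f0 t; apply: cvgV => //; exact: cf. Qed.

Lemma cont_ln f : continuous f -> (forall t, 0 < f t) ->
  continuous (fun t => ln (f t)).
Proof.
by move=> cf f0 t; apply: continuous_comp; [exact: cf|exact: continuous_ln].
Qed.

Lemma cont_sqrt f : continuous f -> continuous (fun t => Num.sqrt (f t)).
Proof.
by move=> cf t; apply: continuous_comp; [exact: cf|exact: sqrt_continuous].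
Qed.

Lemma cont_affine f (a b : R) : continuous f -> continuous (fun t => f (a * t + b)).
Proof.
move=> cf t; apply: (@continuous_comp _ _ _ (fun t => a * t + b)); last exact: cf.
by apply: cont_add; [apply: cont_mul; [exact: cont_cst|move=> ?; exact: cvg_id]|exact: cont_cst].
Qed.

Lemma cont_sum (I : Type) (s : seq I) (f : I -> R -> R) :
  (forall i, continuous (f i)) -> continuous (fun t => \sum_(i <- s) f i t).
Proof.
move=> cf; elim: s => [|i s IH].
  by under eq_fun do rewrite big_nil; exact: cont_cst.
by under eq_fun do rewrite big_cons; exact: cont_add.
Qed.

Lemma cont_cos2pi : continuous (fun t : R => cos (2 * pi * t)).
Proof.
have := @cont_affine (@cos R) (2 * pi) 0 (@continuous_cos R).
by under eq_fun do rewrite addr0.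
Qed.

Lemma cont_sin2pi : continuous (fun t : R => sin (2 * pi * t)).
Proof.
have := @cont_affine (@sin R) (2 * pi) 0 (@continuous_sin R).
by under eq_fun do rewrite addr0.
Qed.

(** The power need not be differentiable at 0, so zeros of [f] get a direct estimate with radius
    [eps^(1/q)]; elsewhere differentiability gives continuity. *)
Lemma cont_powR f (q : R) : 0 < q -> continuous f -> (forall t, 0 <= f t) ->
  continuous (fun t => f t `^ q).
Proof.
move=> q0 cf f0 t; have := f0 t; rewrite le_eqVlt => /predU1P[ft0|ft0].
  rewrite /continuous_at -ft0 powR0 ?gt_eqF//; apply/cvgrPdist_lt => eps eps0.
  have e'0 : 0 < eps `^ q^-1 by rewrite powR_gt0.
  have /cvgrPdist_lt /(_ _ e'0) := cf t.
  rewrite -ft0; apply: filterS => u; rewrite !sub0r !normrN !ger0_norm ?powR_ge0//.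
  move=> fu; have -> : eps = (eps `^ q^-1) `^ q.
    by rewrite -powRrM mulVf ?gt_eqF// powRr1// ltW.
  by rewrite gt0_ltr_powR// ?nnegrE ?powR_ge0.
apply: (@continuous_comp _ _ _ f (fun a => a `^ q)); first exact: cf.
apply: differentiable_continuous; apply/derivable1_diffP.
by apply: derivable_powR; rewrite in_itv/= ft0.
Qed.

End Continuity.

Ltac cont := repeat first [ assumption | lazymatch goal with
  | |- continuous (fun _ => ?c) => exact: cont_cst
  | |- continuous (fun t => @?f t + @?g t) => apply: (@cont_add _ f g)
  | |- continuous (fun t => - @?f t) => apply: (@cont_opp _ f)
  | |- continuous (fun t => @?f t * @?g t) => apply: (@cont_mul _ f g)
  | |- continuous (fun t => @?f t ^+ ?n) => apply: (@cont_exp _ f n)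
  end | exact: cont_cos2pi | exact: cont_sin2pi ].

(** * The logarithmic mean of |1 + x e(t)| *)

Section Poisson.
Context {R : realType}.

Definition cos1 (t : R) : R := cos (2 * pi * t).

Lemma cos1_le1 t : -1 <= cos1 t <= 1.
Proof. by rewrite cos_geN1 cos_le1. Qed.

Lemma cos1Dhalf t : cos1 (t + 2^-1) = - cos1 t.
Proof.
rewrite /cos1 (_ : 2 * pi * _ = 2 * pi * t + pi) ?cosDpi//.
by rewrite mulrDr [2 * pi]mulrC -[pi * 2 * 2^-1]mulrA divff ?mulr1// pnatr_eq0.
Qed.

Lemma cos1D1 t : cos1 (t + 1) = cos1 t.
Proof.
by rewrite (_ : t + 1 = t + 2^-1 + 2^-1) ?cos1Dhalf ?opprK//; field.
Qed.

Lemma cos1_double t : cos1 (2 * t) = 2 * cos1 t ^+ 2 - 1.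
Proof.
rewrite /cos1 (_ : 2 * pi * (2 * t) = (2 * pi * t) *+ 2); last by ring.
by rewrite cos_mulr2n -mulr_natl.
Qed.

Lemma mean_shift (h : R -> R) s : continuous h -> (forall t, h (t + 1) = h t) ->
  mean (fun t => h (t + s)) = mean h.
Proof.
move=> ch hP; rewrite -(@mean_affine _ h 1 s)//.
by apply: eq_mean => t; rewrite mul1r.
Qed.

Lemma mean_cos1 : mean cos1 = 0 :> R.
Proof.
have := @mean_shift cos1 2^-1 cont_cos2pi cos1D1.
under eq_mean do rewrite cos1Dhalf.
have -> : mean (fun t => - cos1 t) = - mean cos1.
  under eq_mean do rewrite -mulN1r.
  by rewrite meanZ ?mulN1r//; exact: cont_cos2pi.
lra.
Qed.

(* |1 + x e(t)|^2 *)
Definition sqdist (x t : R) : R := 1 + x ^+ 2 + 2 * x * cos1 t.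

Lemma cont_sqdist x : continuous (sqdist x).
Proof. by rewrite /sqdist; cont. Qed.

Lemma sqdistD1 x t : sqdist x (t + 1) = sqdist x t.
Proof. by rewrite /sqdist cos1D1. Qed.

Lemma sqdist_ge x t : 0 <= x -> (1 - x) ^+ 2 <= sqdist x t.
Proof. by move=> x0; have := cos1_le1 t; rewrite /sqdist; nra. Qed.

Lemma sqdist_le x t : 0 <= x -> sqdist x t <= (1 + x) ^+ 2.
Proof. by move=> x0; have := cos1_le1 t; rewrite /sqdist; nra. Qed.

Lemma sqdist_ge0 x t : 0 <= x -> 0 <= sqdist x t.
Proof. by move=> /(sqdist_ge t); apply: le_trans; exact: sqr_ge0. Qed.

Lemma sqdist_gt0 x t : 0 <= x < 1 -> 0 < sqdist x t.
Proof.
move=> /andP[x0 x1]; apply: lt_le_trans (sqdist_ge t x0).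
by rewrite exprn_gt0// subr_gt0.
Qed.

Lemma mean_sqdist x : mean (sqdist x) = 1 + x ^+ 2.
Proof.
rewrite /sqdist meanD; [|by cont..].
by rewrite mean_cst meanZ ?mean_cos1 ?mulr0 ?addr0//; exact: cont_cos2pi.
Qed.

(** With [z = e t], this is the squared modulus of [(1 + x z) (1 - x z) = 1 - x^2 z^2]: a
    half-period shift changes the sign of [z]. *)
Lemma sqdist_double x t :
  sqdist x t * sqdist x (t + 2^-1) = sqdist (x ^+ 2) (2 * t + 2^-1).
Proof. by rewrite /sqdist !cos1Dhalf cos1_double; ring. Qed.

Lemma mean_sqdist_double (f : R -> R) x : continuous (f \o sqdist x) ->
  continuous (f \o sqdist (x ^+ 2)) ->
  mean (fun t => f (sqdist x (t + 2^-1))) = mean (fun t => f (sqdist x t)) /\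
  mean (fun t => f (sqdist (x ^+ 2) (2 * t + 2^-1))) = mean (fun t => f (sqdist (x ^+ 2) t)).
Proof.
move=> c1 c2; split.
  by apply: (@mean_shift (f \o sqdist x)) => // t; rewrite /= sqdistD1.
by apply: (@mean_affine _ (f \o sqdist (x ^+ 2)) 2) => // t; rewrite /= sqdistD1.
Qed.

(* Iterating [x |-> x ^+ 2] drives [x] to 0, where the bound is 0. *)
Lemma squaring_descent (f : R -> R) :
  (forall x, 0 <= x < 1 -> `|f x| <= `|f (x ^+ 2)|) ->
  (forall x, 0 <= x < 1 -> `|f x| <= 2 * x / (1 - x)) ->
  forall x, 0 <= x < 1 -> f x = 0.
Proof.
move=> f2 fb x /andP[x0 x1].
have sq01 n : 0 <= x ^+ n.+1 <= x.
  by rewrite exprn_ge0//= exprS -[leRHS]mulr1 ler_wpM2l// exprn_ile1// ltW.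
(* Squaring doubles the exponent [(k + n).+1], which then is at least [k.+2]; the excess goes into
   the new [n]. *)
have it k : exists n, `|f x| <= `|f (x ^+ (k + n).+1)|.
  elim: k => [|k [n IH]]; first by exists 0%N; rewrite expr1.
  exists (k + n + n)%N; apply: le_trans IH _; apply: le_trans (f2 _ _) _.
    by have /andP[-> /le_lt_trans->] := sq01 (k + n)%N.
  by rewrite -exprM (_ : (k + n).+1 * 2 = (k.+1 + (k + n + n)).+1)%N//; lia.
apply/eqP; rewrite -normr_eq0; apply/negPn/negP => fx.
have {}fx : 0 < `|f x| by rewrite lt_neqAle eq_sym fx /=.
(* Chosen so that [y < eps] and [y <= x] force [2 * y / (1 - y)] below the modulus of [f x]. *)
pose eps := `|f x| * (1 - x) / 2.
have eps0 : 0 < eps by rewrite /eps divr_gt0// mulr_gt0// subr_gt0.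
have /(@cvg_expr R)/cvgrPdist_lt/(_ _ eps0) : `|x| < 1 by rewrite ger0_norm.
case=> k _ /(_ k (leqnn k)) /=; rewrite sub0r normrN ger0_norm ?exprn_ge0// => xk.
have [n le_n] := it k.
set y := x ^+ (k + n).+1 in le_n.
have /andP[y0 yx] : 0 <= y <= x := sq01 _.
have yk : y <= x ^+ k.
  by rewrite /y -addnS exprD -[leRHS]mulr1 ler_wpM2l ?exprn_ge0// exprn_ile1// ltW.
have y1 : y < 1 by apply: le_lt_trans yx x1.
have : `|f x| <= 2 * y / (1 - y) by apply: le_trans le_n (fb _ _); rewrite y0.
rewrite ler_pdivlMr ?subr_gt0// => le2.
have : eps * 2 <= 2 * y.
  rewrite /eps divfK ?pnatr_eq0//; apply: le_trans le2.
  by rewrite ler_wpM2l// lerB.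
by rewrite [2 * y]mulrC ler_pM2r// leNgt (le_lt_trans yk xk).
Qed.

(** By [sqdist_double] the mean doubles when [x] becomes [x ^+ 2], so [squaring_descent] applies;
    the bound near 0 comes from the extreme values of [sqdist] and [ln (1 + u) <= u]. *)
Lemma mean_ln_sqdist x : 0 <= x < 1 -> mean (fun t => ln (sqdist x t)) = 0.
Proof.
have c y : 0 <= y < 1 -> continuous (@ln R \o sqdist y).
  by move=> y01; apply: cont_ln (@cont_sqdist _) _ => t; exact: sqdist_gt0.
apply: (@squaring_descent (fun x => mean (fun t => ln (sqdist x t)))) => {}x x01.
  have x201 : 0 <= x ^+ 2 < 1 by case/andP: x01 => ? ?; rewrite sqr_ge0/= expr_lt1.
  have [e1 e2] := mean_sqdist_double (c _ x01) (c _ x201).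
  rewrite -[in leRHS]e2.
  have -> : mean (fun t => ln (sqdist (x ^+ 2) (2 * t + 2^-1))) =
      2 * mean (fun t => ln (sqdist x t)).
    rewrite [RHS]mulr_natl [RHS]mulr2n -{2}e1 -meanD; last 2 first.
    - exact: c.
    - have := @cont_affine _ _ 1 2^-1 (c _ x01); rewrite /comp/=.
      by under eq_fun do rewrite mul1r.
    by apply: eq_mean => t; rewrite -sqdist_double lnM// posrE sqdist_gt0.
  rewrite normrM ger0_norm// ler_peMl// ?ler1n//.
have /andP[x0 x1] := x01.
have x1' : 0 < 1 - x by rewrite subr_gt0.
have bnd t : - (2 * x / (1 - x)) <= ln (sqdist x t) <= 2 * x / (1 - x).
  have lnsq (y : R) : 0 < y -> ln (y ^+ 2) = 2 * ln y.
    by move=> y0; rewrite lnXn// mulr_natl.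
  have xx : x <= x / (1 - x) by rewrite ler_pdivlMr// ler_piMr// gerBl.
  have D0 := sqdist_gt0 t x01.
  apply/andP; split.
    have : ln ((1 - x) ^+ 2) <= ln (sqdist x t).
      by rewrite ler_ln ?posrE ?exprn_gt0// sqdist_ge.
    apply: le_trans; rewrite lnsq// -mulrA -mulrN ler_wpM2l// lerNl -lnV//.
    have {1}-> : (1 - x)^-1 = 1 + x / (1 - x) by field; rewrite gt_eqF.
    by apply: le_ln1Dx; apply: lt_le_trans (_ : 0 <= _); rewrite ?ltrN10// divr_ge0// ltW.
  apply: (@le_trans _ _ (ln ((1 + x) ^+ 2))).
    by rewrite ler_ln ?posrE ?exprn_gt0// ?sqdist_le//; lra.
  rewrite lnsq; last lra.
  rewrite -mulrA ler_wpM2l//; apply: le_trans (le_ln1Dx _) xx; lra.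
rewrite ler_norml; apply/andP; split.
  rewrite -[leLHS]mean_cst; apply: le_mean; [exact: cont_cst|exact: c|].
  by move=> t; case/andP: (bnd t).
rewrite -[leRHS]mean_cst; apply: le_mean; [exact: c|exact: cont_cst|].
by move=> t; case/andP: (bnd t).
Qed.

(** This normalises the Poisson kernel. The defect of its mean from 1 is invariant under [x -> x^2],
    so [squaring_descent] makes it vanish. *)
Lemma mean_inv_sqdist x : 0 <= x < 1 ->
  mean (fun t => (sqdist x t)^-1) = (1 - x ^+ 2)^-1.
Proof.
have c y : 0 <= y < 1 -> continuous (@GRing.inv R \o sqdist y).
  by move=> y01; apply: cont_inv (@cont_sqdist _) _ => t; rewrite gt_eqF// sqdist_gt0.
suff Q : forall x, 0 <= x < 1 ->
    (1 - x ^+ 2) * mean (fun t => (sqdist x t)^-1) - 1 = 0.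
  move=> x01; have := Q _ x01 => /eqP; rewrite subr_eq0 => /eqP Q1.
  apply: (@mulfI _ (1 - x ^+ 2)).
    by rewrite subr_eq0 eq_sym lt_eqF// expr_lt1//; case/andP: x01.
  rewrite Q1 divff// subr_eq0 eq_sym lt_eqF// expr_lt1//; by case/andP: x01.
apply: squaring_descent => {}x x01.
  have x201 : 0 <= x ^+ 2 < 1 by case/andP: x01 => ? ?; rewrite sqr_ge0/= expr_lt1.
  have [e1 e2] := mean_sqdist_double (c _ x01) (c _ x201).
  rewrite -[in leRHS]e2.
  (* Pointwise, [1/D + 1/D' = (D + D') / (D D')], where [D + D' = 2 (1 + x^2)] and [sqdist_double]
     gives the product. *)
  have E : 2 * (1 + x ^+ 2) * mean (fun t => (sqdist (x ^+ 2) (2 * t + 2^-1))^-1) =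
      2 * mean (fun t => (sqdist x t)^-1).
    rewrite [RHS]mulr_natl [RHS]mulr2n -{2}e1 -meanD; last 2 first.
    - exact: c.
    - have := @cont_affine _ _ 1 2^-1 (c _ x01); rewrite /comp/=.
      by under eq_fun do rewrite mul1r.
    rewrite -meanZ; last exact: (@cont_affine _ _ 2 2^-1 (c _ x201)).
    apply: eq_mean => t; rewrite -sqdist_double.
    have D1 := sqdist_gt0 t x01; have D2 := sqdist_gt0 (t + 2^-1) x01.
    have -> : 2 * (1 + x ^+ 2) = sqdist x t + sqdist x (t + 2^-1).
      by rewrite /sqdist cos1Dhalf; ring.
    by field; rewrite !gt_eqF.
  (* The two defects are equal, because [(1 - x^2) (1 + x^2) = 1 - x^4]. *)
  rewrite le_eqVlt; apply/orP; left; apply/eqP; congr (`|_ - _|).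
  have -> : mean (fun t => (sqdist x t)^-1) =
      (1 + x ^+ 2) * mean (fun t => (sqdist (x ^+ 2) (2 * t + 2^-1))^-1) by lra.
  by ring.
have /andP[x0 x1] := x01.
have xn : 0 < 1 - x by rewrite subr_gt0.
have xp : 0 < 1 + x by lra.
have lo : ((1 + x) ^+ 2)^-1 <= mean (fun t => (sqdist x t)^-1).
  rewrite -[leLHS]mean_cst; apply: le_mean; [exact: cont_cst|exact: c|] => t.
  by rewrite lef_pV2 ?posrE ?exprn_gt0 ?sqdist_gt0// sqdist_le.
have hi : mean (fun t => (sqdist x t)^-1) <= ((1 - x) ^+ 2)^-1.
  rewrite -[leRHS]mean_cst; apply: le_mean; [exact: c|exact: cont_cst|] => t.
  by rewrite lef_pV2 ?posrE ?exprn_gt0 ?sqdist_gt0// sqdist_ge.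
set m := mean _ in lo hi *.
have {}lo : (1 - x) / (1 + x) <= (1 - x ^+ 2) * m.
  have -> : (1 - x) / (1 + x) = (1 - x ^+ 2) * ((1 + x) ^+ 2)^-1.
    by field; rewrite gt_eqF.
  by rewrite ler_pM2l// subr_gt0 expr_lt1.
have {}hi : (1 - x ^+ 2) * m <= (1 + x) / (1 - x).
  have -> : (1 + x) / (1 - x) = (1 - x ^+ 2) * ((1 - x) ^+ 2)^-1.
    by field; rewrite gt_eqF.
  by rewrite ler_pM2l// subr_gt0 expr_lt1.
rewrite ler_norml; apply/andP; split.
  apply: le_trans (_ : (1 - x) / (1 + x) - 1 <= _); last by rewrite lerD2r.
  have -> : (1 - x) / (1 + x) - 1 = - (2 * x / (1 + x)) by field; rewrite gt_eqF.
  by rewrite lerN2 ler_wpM2l ?mulr_ge0// lef_pV2 ?posrE//; lra.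
apply: le_trans (_ : (1 + x) / (1 - x) - 1 <= _); first by rewrite lerD2r.
by have -> : (1 + x) / (1 - x) - 1 = 2 * x / (1 - x) by field; rewrite gt_eqF.
Qed.

(* Integrating [sin (2 pi t) ln (sqdist x t)] by parts leaves
   [sin ^ 2 / sqdist], whose numerator is quadratic in [sqdist]. *)
Lemma mean_cos1_ln_sqdist x : 0 <= x < 1 ->
  mean (fun t => cos1 t * ln (sqdist x t)) = x.
Proof.
move=> x01; have /andP[x0 x1] := x01.
have D0 (t : R) := sqdist_gt0 t x01.
have Dn0 (t : R) : sqdist x t != 0 by rewrite gt_eqF.
have cl : continuous (fun t => ln (sqdist x t)) by apply: cont_ln (@cont_sqdist _) _.
have ci : continuous (fun t => (sqdist x t)^-1) by apply: cont_inv (@cont_sqdist _) _.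
(* The identity for [k] below divides by [2 * x]. *)
have [->|xn0] := eqVneq x 0.
  rewrite -[RHS](@mean_cst R); apply: eq_mean => t.
  by rewrite /sqdist expr0n/= mulr0 mul0r !addr0 ln1 mulr0.
have pi20 : 2 * pi != 0 :> R by rewrite mulf_neq0// ?pnatr_eq0// gt_eqF// pi_gt0.
pose s (t : R) : R := sin (2 * pi * t).
have cs : continuous s by exact: cont_sin2pi.
have cc : continuous cos1 by exact: cont_cos2pi.
pose k (t : R) : R := cos1 t * ln (sqdist x t) - 2 * x * (s t ^+ 2 * (sqdist x t)^-1).
have ck : continuous k by rewrite /k; cont.
(* [k] is the derivative of [sin * ln sqdist / (2 pi)], which vanishes at both ends of the
   period. *)
have k0 : mean k = 0.
  have dk (t : R) : is_derive t (1 : R) (fun u => (2 * pi)^-1 * (s u * ln (sqdist x u))) (k t).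
    have ds : is_derive t (1 : R) s (2 * pi * cos1 t).
      have := @is_derive_affine R sin (2 * pi) 0 t _ (is_derive_sin _).
      by under eq_fun do rewrite addr0; rewrite addr0.
    have dc : is_derive t (1 : R) cos1 (2 * pi * - s t).
      have := @is_derive_affine R cos (2 * pi) 0 t _ (is_derive_cos _).
      by under eq_fun do rewrite addr0; rewrite addr0.
    have dD : is_derive t (1 : R) (sqdist x) (2 * x * (2 * pi * - s t)).
      by rewrite /sqdist; apply: is_derive_eq; rewrite /GRing.scale/=; ring.
    have dl : is_derive t (1 : R) (fun u => ln (sqdist x u))
        ((sqdist x t)^-1 * (2 * x * (2 * pi * - s t))).
      have dln := is_derive1_ln (D0 t).
      by apply: is_derive_eq; rewrite /GRing.scale/= mulrC.
    apply: is_derive_eq; rewrite /GRing.scale/= /k.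
    have pn0 : pi != 0 :> R by rewrite gt_eqF// pi_gt0.
    move: (s t) (ln (sqdist x t)) (cos1 t) (sqdist x t) (Dn0 t) (pi : R) pn0 => S L C Dt Dt0 P P0.
    by field; rewrite Dt0 P0.
  rewrite (mean_FTC ck dk) /s !mulr0 sin0 mul0r mulr0 subr0 mulr1.
  by rewrite mulr_natl sin2pi mul0r mulr0.
have E (t : R) : k t = cos1 t * ln (sqdist x t) +
  (2 * x)^-1 * (sqdist x t + ((1 - x ^+ 2) ^+ 2 * (sqdist x t)^-1 - 2 * (1 + x ^+ 2))).
  rewrite /k.
  (* This is [sin^2 = 1 - cos^2] with [2 x cos1 = sqdist - 1 - x^2]. *)
  suff : 4 * x ^+ 2 * s t ^+ 2 = - sqdist x t ^+ 2 +
     2 * (1 + x ^+ 2) * sqdist x t - (1 - x ^+ 2) ^+ 2.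
    move=> S; have -> : s t ^+ 2 = (4 * x ^+ 2)^-1 * (4 * x ^+ 2 * s t ^+ 2) by field.
    rewrite S; move: (ln (sqdist x t)) (cos1 t) (sqdist x t) (Dn0 t) => L C Dt Dt0.
    by field; rewrite Dt0 xn0.
  by rewrite [s t ^+ 2]sin2cos2 -/(cos1 t) /sqdist; ring.
have cD := @cont_sqdist x.
have : mean k = mean (fun t => cos1 t * ln (sqdist x t)) +
  (2 * x)^-1 * ((1 + x ^+ 2) + ((1 - x ^+ 2) ^+ 2 * (1 - x ^+ 2)^-1 - 2 * (1 + x ^+ 2))).
  rewrite (eq_mean E) meanD; [|by cont..].
  rewrite meanZ; [|by cont].
  rewrite meanD; [|by cont..].
  rewrite meanB; [|by cont..].
  by rewrite meanZ// mean_inv_sqdist// mean_sqdist mean_cst.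
rewrite k0 => /esym/eqP; rewrite addr_eq0 => /eqP ->.
field; rewrite xn0/= subr_eq0 eq_sym lt_eqF// expr_lt1//.
Qed.

End Poisson.

(** * Power means of |1 + x e(t)| *)

Section PowerMeans.
Context {R : realType}.

Lemma powR_convex (p a b u v : R) : 1 <= p -> 0 <= a -> 0 <= b -> a + b = 1 ->
  0 <= u -> 0 <= v -> (a * u + b * v) `^ p <= a * u `^ p + b * v `^ p.
Proof.
move=> p1 a0 b0 ab u0 v0.
have a1 : a <= 1 by lra.
have := @convex_powR R p p1 (Itv01 a0 a1) u v.
rewrite !inE/= !in_itv/= !andbT => /(_ u0 v0).
rewrite convRE [X in X `^ _ <= _ -> _]convRE/=.
by have -> : unstable.onem a = b by rewrite /unstable.onem; lra.
Qed.

(** Convexity of [w^(1/r)] at the points [u^r] and [v^r], raised back to the power [r]. *)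
Lemma powR_concave (r a b u v : R) : 0 < r <= 1 -> 0 <= a -> 0 <= b ->
  a + b = 1 -> 0 <= u -> 0 <= v ->
  a * u `^ r + b * v `^ r <= (a * u + b * v) `^ r.
Proof.
move=> /andP[r0 r1] a0 b0 ab u0 v0.
have rn0 : r != 0 by rewrite gt_eqF.
have K w : 0 <= w -> (w `^ r) `^ r^-1 = w by move=> w0; rewrite -powRrM mulfV// powRr1.
have := @powR_convex r^-1 a b (u `^ r) (v `^ r).
rewrite ?invf_ge1// r1 !K// !powR_ge0 => /(_ _ _ _ _ _ _)/wrap[]// le1.
set w := a * _ + _ in le1 *.
have w0 : 0 <= w by rewrite addr_ge0// mulr_ge0// powR_ge0.
have -> : w = (w `^ r^-1) `^ r by rewrite -powRrM mulVf// powRr1.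
by rewrite ge0_ler_powR// ?nnegrE ?powR_ge0 ?addr_ge0 ?mulr_ge0// ltW.
Qed.

Lemma cont_sqdist_powR (x q : R) : 0 <= x -> 0 < q ->
  continuous (fun t : R => sqdist x t `^ q).
Proof.
by move=> x0 q0; apply: cont_powR => // [|t]; [exact: cont_sqdist|exact: sqdist_ge0].
Qed.

Lemma mean_sqdist_powR_half (x q : R) : 0 <= x -> 0 < q ->
  mean (fun t : R => sqdist x (t + 2^-1) `^ q) = mean (fun t : R => sqdist x t `^ q).
Proof.
move=> x0 q0; apply: (@mean_shift _ (fun t : R => sqdist x t `^ q)).
  exact: cont_sqdist_powR.
by move=> t; rewrite sqdistD1.
Qed.

Lemma cont_sqdist_powR_half (x q : R) : 0 <= x -> 0 < q ->
  continuous (fun t : R => sqdist x (t + 2^-1) `^ q).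
Proof.
move=> x0 q0; have := @cont_affine _ _ 1 2^-1 (cont_sqdist_powR x0 q0).
by under eq_fun do rewrite mul1r.
Qed.

(** Both terms on the right are [A] times convex combinations of [U] and [V], with swapped weights.
    Adding the two concavity inequalities gives [U^r + V^r]; concavity at the points 1 and [x^2]
    bounds [A^r] below. *)
Lemma sqdist_powR_sum_ge (x r t : R) : 0 <= x <= 1 -> 0 < r <= 1 ->
  (1 + x `^ (2 * r)) / 2 * (sqdist 1 t `^ r + sqdist 1 (t + 2^-1) `^ r)
  <= sqdist x t `^ r + sqdist x (t + 2^-1) `^ r.
Proof.
move=> /andP[x0 x1] r01; have [r0 r1] := andP r01.
(* From [1 + x z = (1 + x)/2 (1 + z) + (1 - x)/2 (1 - z)] with orthogonal summands on the circle:
   the squared coefficients are [A a] and [A b], and [A] normalises them to sum 1. *)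
pose A := (1 + x ^+ 2) / 2.
pose a := (1 + x) ^+ 2 / (2 * (1 + x ^+ 2)); pose b := (1 - x) ^+ 2 / (2 * (1 + x ^+ 2)).
have A20 : 1 + x ^+ 2 != 0 by rewrite gt_eqF// ltr_wpDr ?sqr_ge0.
have A0 : 0 <= A by rewrite /A divr_ge0// addr_ge0// sqr_ge0.
have a0 : 0 <= a by rewrite divr_ge0 ?sqr_ge0// mulr_ge0// addr_ge0// sqr_ge0.
have b0 : 0 <= b by rewrite divr_ge0 ?sqr_ge0// mulr_ge0// addr_ge0// sqr_ge0.
have ab : a + b = 1 by rewrite /a /b; field; rewrite A20.
have ba : b + a = 1 by rewrite addrC.
set U := sqdist 1 t; set V := sqdist 1 (t + 2^-1).
have U0 : 0 <= U by exact: sqdist_ge0.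
have V0 : 0 <= V by exact: sqdist_ge0.
have -> : sqdist x t = A * (a * U + b * V).
  by rewrite /U /V /A /a /b /sqdist cos1Dhalf; field; rewrite A20.
have -> : sqdist x (t + 2^-1) = A * (b * U + a * V).
  by rewrite /U /V /A /a /b /sqdist cos1Dhalf; field; rewrite A20.
have c1 := powR_concave r01 a0 b0 ab U0 V0.
have c2 := powR_concave r01 b0 a0 ba U0 V0.
have h0 : 0 <= 2^-1 :> R by [].
have hh : 2^-1 + 2^-1 = 1 :> R by field.
have c3 := powR_concave r01 h0 h0 hh ler01 (sqr_ge0 x).
have W1 : 0 <= a * U + b * V by rewrite addr_ge0// mulr_ge0.
have W2 : 0 <= b * U + a * V by rewrite addr_ge0// mulr_ge0.
rewrite powRM// powRM// -mulrDr.
apply: ler_pM; rewrite ?divr_ge0 ?addr_ge0 ?powR_ge0//.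
  rewrite /A mulrC mulrDr.
  have -> : (1 + x ^+ 2) / 2 = 2^-1 * 1 + 2^-1 * x ^+ 2 by field.
  by apply: le_trans c3; rewrite powR1 -(powR_mulrn _ x0) -powRrM.
have {}ab : a = 1 - b by lra.
by move: c1 c2; rewrite ab; lra.
Qed.

(** A half-period shift preserves the mean, so both sides of the pointwise bound integrate to twice
    the desired quantities. *)
Lemma mean_sqdist_powR_ge_pair (x r : R) : 0 <= x <= 1 -> 0 < r <= 1 ->
  (1 + x `^ (2 * r)) / 2 * mean (fun t : R => sqdist 1 t `^ r)
  <= mean (fun t : R => sqdist x t `^ r).
Proof.
move=> x01 r01; have [x0 x1] := andP x01; have [r0 r1] := andP r01.
have cx := cont_sqdist_powR x0 r0; have cx' := cont_sqdist_powR_half x0 r0.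
have c1 := cont_sqdist_powR ler01 r0; have c1' := cont_sqdist_powR_half ler01 r0.
have := @le_mean _ _ _ _ _ (fun t : R => sqdist_powR_sum_ge t x01 r01).
rewrite meanZ ?meanD//; last by cont.
rewrite !mean_sqdist_powR_half// => /(_ _ _)/wrap[]; [by cont|by cont|].
set m1 := mean _; set mx := mean _; set k := (1 + _) / 2.
by rewrite -!mulr2n mulrnAr lerMn2r.
Qed.

(* [1 + x e = a (1 + e) + b (1 - e)] with [1 + e] and [1 - e] orthogonal. *)
Lemma mean_sqdist_powR_le1 (x q : R) : 0 <= x <= 1 -> 2^-1 <= q ->
  mean (fun t : R => sqdist x t `^ q) <= mean (fun t : R => sqdist 1 t `^ q).
Proof.
move=> /andP[x0 x1] q2.
have q0 : 0 < q by lra.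
pose a := (1 + x) / 2; pose b := (1 - x) / 2.
have a0 : 0 <= a by rewrite /a; lra.
have b0 : 0 <= b by rewrite /b; lra.
have ab : a + b = 1 by rewrite /a /b; lra.
have c1 := cont_sqdist_powR ler01 q0; have c1' := cont_sqdist_powR_half ler01 q0.
have -> : mean (fun t : R => sqdist 1 t `^ q) =
   mean (fun t : R => a * sqdist 1 t `^ q + b * sqdist 1 (t + 2^-1) `^ q).
  rewrite meanD; [|by cont..].
  by rewrite !meanZ// mean_sqdist_powR_half// -mulrDl ab mul1r.
apply: le_mean; [exact: cont_sqdist_powR|by cont|] => t.
set U := sqdist 1 t; set V := sqdist 1 (t + 2^-1).
have U0 : 0 <= U by exact: sqdist_ge0.
have V0 : 0 <= V by exact: sqdist_ge0.
have D : sqdist x t = a ^+ 2 * U + b ^+ 2 * V.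
  by rewrite /U /V /a /b /sqdist cos1Dhalf; field.
have pw w : 0 <= w -> w `^ q = Num.sqrt w `^ (2 * q).
  by move=> w0; rewrite powRrM powR_mulrn ?sqrtr_ge0// sqr_sqrtr.
(* With square roots the exponent becomes [2 * q >= 1], where convexity is available. *)
rewrite (pw U)// (pw V)//.
apply: le_trans (powR_convex _ a0 b0 ab (sqrtr_ge0 U) (sqrtr_ge0 V)); last by lra.
rewrite pw ?sqdist_ge0//.
have ab0 : 0 <= a * Num.sqrt U + b * Num.sqrt V by rewrite addr_ge0// mulr_ge0// sqrtr_ge0.
apply: ge0_ler_powR; rewrite ?nnegrE ?sqrtr_ge0 ?mulr_ge0 ?(ltW q0)//.
(* Compare squares: [a^2 U + b^2 V] differs from the square of [a sqrt U + b sqrt V] by a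
   nonnegative cross term. *)
rewrite -[leRHS]ger0_norm// -sqrtr_sqr ler_wsqrtr// D.
rewrite -{1}(sqr_sqrtr U0) -{1}(sqr_sqrtr V0).
have := mulr_ge0 (mulr_ge0 a0 b0) (mulr_ge0 (sqrtr_ge0 U) (sqrtr_ge0 V)).
by nra.
Qed.

(* Tangent line of [exp] at [ln (l * sqdist y t)]; the right-hand side is
   explicit since [mean ln sqdist] and [mean cos1 ln sqdist] are. *)
Lemma mean_sqdist_powR_ge_tangent (x y q l : R) : 0 <= x < 1 -> 0 <= y < 1 ->
  0 < q -> 0 < l ->
  l * ((1 + y ^+ 2) * (1 - ln l) + 2 * q * x * y - 2 * y ^+ 2)
  <= mean (fun t : R => sqdist x t `^ q).
Proof.
move=> x01 y01 q0 l0.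
have cl z : 0 <= z < 1 -> continuous (fun t : R => ln (sqdist z t)).
  by move=> z01; apply: cont_ln (@cont_sqdist _ _) _ => t; exact: sqdist_gt0.
have clx := cl _ x01; have cly := cl _ y01.
have cc : continuous (@cos1 R) by exact: cont_cos2pi.
have ccx : continuous (fun t : R => cos1 t * ln (sqdist x t)) by cont.
have ccy : continuous (fun t : R => cos1 t * ln (sqdist y t)) by cont.
(* The tangent line [l D (1 + q ln D' - ln l - ln D)], with [D] and [D'] the values of [sqdist] at
   [y] and [x]. The factor [D] before the logarithms is expanded as [1 + y^2 + 2 y cos1], so that
   every mean is known. *)
pose G t := (l * (1 + y ^+ 2)) * (q * ln (sqdist x t) + - ln (sqdist y t)) +
   ((l * (2 * y)) * (q * (cos1 t * ln (sqdist x t)) + - (cos1 t * ln (sqdist y t)))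
   + l * (1 - ln l) * sqdist y t).
have cD := @cont_sqdist R y.
have <- : mean G = l * ((1 + y ^+ 2) * (1 - ln l) + 2 * q * x * y - 2 * y ^+ 2).
  rewrite /G.
  rewrite meanD; [|by cont..].
  rewrite meanD; [|by cont..].
  rewrite !meanZ; [|by cont..].
  rewrite !meanB; [|by cont..].
  rewrite !meanZ//.
  rewrite !mean_ln_sqdist// !mean_cos1_ln_sqdist// mean_sqdist.
  by ring.
apply: le_mean; [by rewrite /G; cont|apply: cont_sqdist_powR => //; by case/andP: x01|] => t.
have Dx := sqdist_gt0 t x01; have Dy := sqdist_gt0 t y01.
rewrite /powR gt_eqF//.
set Lx := ln (sqdist x t); set Ly := ln (sqdist y t).
have -> : G t = l * sqdist y t * (1 + (q * Lx - (ln l + Ly))).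
  by rewrite /G -/Lx -/Ly /sqdist; ring.
have {1}-> : l * sqdist y t = expR (ln l + Ly) by rewrite expRD !lnK.
have -> : q * Lx = (ln l + Ly) + (q * Lx - (ln l + Ly)) by ring.
rewrite [leRHS]expRD ler_wpM2l ?expR_ge0// (_ : forall a b : R, a + b - a = b); last by move=> *; ring.
exact: expR_ge1Dx.
Qed.

(** Passage to [y = 1] in a quadratic inequality known only for [y < 1]; it serves both the tangent
    parameter and the endpoint [x = 1]. *)
Lemma le_affine_limit (A B C c : R) :
  (forall y, 0 <= y < 1 -> A + B * y + C * y ^+ 2 <= c) -> A + B + C <= c.
Proof.
move=> H; apply/ler_addgt0Pr => eps eps0.
(* At [y = 1 - d] the quadratic falls short of its value at 1 by at most [K * d], and [d <= 1] keeps
   [y >= 0]. *)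
pose K := `|B| + 2 * `|C| + 1.
have K1 : 1 <= K by rewrite /K lerDr addr_ge0// mulr_ge0.
have K0 : 0 < K by apply: lt_le_trans K1.
pose d := Num.min 1 (eps / K).
have d0 : 0 < d by rewrite lt_min ltr01 divr_gt0.
have d1 : d <= 1 by rewrite ge_min lexx.
have dK : d * K <= eps by rewrite -ler_pdivlMr// ge_min lexx orbT.
have := H (1 - d); rewrite subr_ge0 d1 gtrBl d0 => /(_ isT) {}H.
have [B1 C1] : B <= `|B| /\ C <= `|C| by split; exact: ler_norm.
have Bd : B * d <= `|B| * d by rewrite ler_wpM2r// ltW.
have Cd : C * (d * (2 - d)) <= `|C| * (2 * d).
  apply: le_trans (_ : `|C| * (d * (2 - d)) <= _).
    by rewrite ler_wpM2r// mulr_ge0// ?(ltW d0)//; lra.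
  by rewrite ler_wpM2l//; nra.
move: dK; rewrite /K; nra.
Qed.

(** Integrate [1 + t <= expR t] over [[0, z]]. *)
Lemma expR_ge_quadratic (z : R) : 0 <= z -> 1 + z + z ^+ 2 / 2 <= expR z.
Proof.
rewrite le_eqVlt => /predU1P[<-|z0].
  by rewrite expR0 expr0n/= mul0r !addr0.
pose H (t : R) : R := expR t - t - t * t / 2.
have dH (t : R) : is_derive t (1 : R) H (expR t - 1 - t).
  by rewrite /H; apply: is_derive_eq; rewrite /GRing.scale/=; field.
have ch : continuous (fun t : R => expR t - 1 - t).
  by cont; [exact: continuous_expR|move=> ?; exact: cvg_id].
have := @continuous_FTC R _ H 0 z z0 ch (fun t _ => dH t).
suff : 0 <= \int[lebesgue_measure]_(t in `[0, z]) (expR t - 1 - t).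
  by move=> i0 E; move: i0; rewrite E /H expR0 !mul0r expr2; lra.
by apply: Rintegral_ge0 => t _; have := expR_ge1Dx t; lra.
Qed.

Lemma sqr_le_expR (y : R) : 1 <= y -> 1 + y ^+ 2 <= 2 * expR (y - 1).
Proof.
move=> y1; have := @expR_ge_quadratic (y - 1); rewrite subr_ge0 => /(_ y1).
by rewrite !expr2; lra.
Qed.

Lemma mean_sqdist_powR_ge_lt1 (x q : R) : 0 <= x < 1 -> 0 < q ->
  1 + q ^+ 2 * x ^+ 2 <= mean (fun t : R => sqdist x t `^ q).
Proof.
move=> x01 q0; have [x0 x1] := andP x01.
have [qx1|qx1] := ltP (q * x) 1.
  (* For [l = 1] the tangent bound is [1 + 2 q x y - y^2], largest at [y = q x]. *)
  have qx01 : 0 <= q * x < 1 by rewrite mulr_ge0// ltW.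
  apply: le_trans (mean_sqdist_powR_ge_tangent x01 qx01 q0 ltr01).
  by rewrite ln1 le_eqVlt; apply/orP; left; apply/eqP; ring.
(* This [l] maximises the bound at [y = 1], where it equals [2 * l]. The tangent bound requires
   [y < 1], so that value is reached as a limit. *)
pose l := expR (q * x - 1).
have l0 : 0 < l by exact: expR_gt0.
have lnl : ln l = q * x - 1 by rewrite expRK.
have T y : 0 <= y < 1 -> l * (1 - ln l) + l * 2 * q * x * y + l * (- 1 - ln l) * y ^+ 2
    <= mean (fun t : R => sqdist x t `^ q).
  move=> y01; apply: le_trans (mean_sqdist_powR_ge_tangent x01 y01 q0 l0).
  by rewrite le_eqVlt; apply/orP; left; apply/eqP; ring.
apply: le_trans (le_affine_limit T); rewrite lnl.
apply: le_trans (_ : 2 * l <= _).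
  by rewrite -exprMn; exact: sqr_le_expR.
by rewrite le_eqVlt; apply/orP; left; apply/eqP; ring.
Qed.

(** For [x = 1] the logarithmic means are not at hand; the bound for [y < 1] is carried to the mean
    at 1 by [mean_sqdist_powR_le1], and then [y] tends to 1. *)
Lemma mean_sqdist_powR_ge (x q : R) : 0 <= x <= 1 -> 2^-1 <= q ->
  1 + q ^+ 2 * x ^+ 2 <= mean (fun t : R => sqdist x t `^ q).
Proof.
move=> /andP[x0]; have q0 : 2^-1 <= q -> 0 < q by move=> ?; lra.
rewrite le_eqVlt => /predU1P[->|x1] q2; last first.
  by apply: mean_sqdist_powR_ge_lt1; rewrite ?x0 ?q0.
have := @le_affine_limit 1 0 (q ^+ 2) (mean (fun t : R => sqdist 1 t `^ q)).
rewrite addr0 expr1n mulr1; apply=> y /andP[y0 y1].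
rewrite mul0r addr0; apply: le_trans (mean_sqdist_powR_le1 _ q2).
  by apply: mean_sqdist_powR_ge_lt1; rewrite ?y0 ?q0.
by rewrite y0 ltW.
Qed.

End PowerMeans.

(** * Polynomials on the unit circle *)

Section ComplexModulus.
Context {R : realType}.
Implicit Types z w : R[i].

Lemma cabsE z : cabs z = Num.sqrt (complex.Re z ^+ 2 + complex.Im z ^+ 2).
Proof. by rewrite /cabs normc_def. Qed.

Lemma cabsC z : (cabs z)%:C%C = `|z|.
Proof. by rewrite /cabs normc_def. Qed.

Lemma cabs_ge0 z : 0 <= cabs z.
Proof. by rewrite cabsE sqrtr_ge0. Qed.

Lemma sqr_cabs z : cabs z ^+ 2 = complex.Re z ^+ 2 + complex.Im z ^+ 2.
Proof. by rewrite cabsE sqr_sqrtr// addr_ge0// sqr_ge0. Qed.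

Lemma cabsM z w : cabs (z * w) = cabs z * cabs w.
Proof. by apply: complexI; rewrite rmorphM/= !cabsC normrM. Qed.

Lemma cabs0 : cabs (0 : R[i]) = 0.
Proof. by apply: complexI; rewrite cabsC normr0. Qed.

Lemma cabs1 : cabs (1 : R[i]) = 1.
Proof. by apply: complexI; rewrite cabsC normr1. Qed.

Lemma cabsN z : cabs (- z) = cabs z.
Proof. by apply: complexI; rewrite !cabsC normrN. Qed.

Lemma cabsV z : cabs z^-1 = (cabs z)^-1.
Proof. by apply: complexI; rewrite fmorphV/= !cabsC normfV. Qed.

Lemma cabs_eq0 z : (cabs z == 0) = (z == 0).
Proof. by rewrite -[z == 0]normr_eq0 -cabsC -(inj_eq (@complexI R)). Qed.

Lemma cabs_real (x : R) : cabs x%:C%C = `|x|.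
Proof. by rewrite cabsE/= expr0n/= addr0 sqrtr_sqr. Qed.

Lemma cabs_conj z : cabs (conjc z) = cabs z.
Proof. by case: z => a b; rewrite !cabsE/= sqrrN. Qed.

Lemma cabs_prod (I : Type) (s : seq I) (f : I -> R[i]) :
  cabs (\prod_(i <- s) f i) = \prod_(i <- s) cabs (f i).
Proof.
by elim: s => [|i s IH]; rewrite ?big_nil ?cabs1// !big_cons cabsM IH.
Qed.

Lemma cabs_sum (I : Type) (s : seq I) (f : I -> R[i]) :
  cabs (\sum_(i <- s) f i) <= \sum_(i <- s) cabs (f i).
Proof.
have := ler_norm_sum s f xpredT.
rewrite -cabsC -(eq_bigr _ (fun i _ => cabsC (f i))).
by rewrite -rmorph_sum/= lecR.
Qed.

Lemma eD (s t : R) : e (s + t) = e s * e t.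
Proof.
apply/eqP; rewrite eq_complex /= /e mulrDr cosD sinD.
by rewrite eqxx/= addrC [X in _ + X]mulrC eqxx.
Qed.

Lemma e0 : e 0 = 1 :> R[i].
Proof. by rewrite /e mulr0 cos0 sin0. Qed.

Lemma e1 : e 1 = 1 :> R[i].
Proof. by rewrite /e mulr1 mulr_natl cos2pi sin2pi. Qed.

Lemma eX (t : R) n : e t ^+ n = e (n%:R * t).
Proof.
elim: n => [|n IH]; first by rewrite mul0r e0 expr0.
by rewrite exprS IH -eD -natr1 mulrDl mul1r addrC.
Qed.

Lemma e_nat n : e n%:R = 1 :> R[i].
Proof. by rewrite -[n%:R]mulr1 -eX e1 expr1n. Qed.

Lemma eN (t : R) : e (- t) = conjc (e t).
Proof. by rewrite /e mulrN cosN sinN. Qed.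

Lemma cabs_e (t : R) : cabs (e t) = 1.
Proof. by rewrite cabsE/= cos2Dsin2 sqrtr1. Qed.

(** The real part is [1 - 2 sin^2 (pi t)], and the sine is positive on [(0, pi)]. *)
Lemma e_neq1 (t : R) : 0 < t < 1 -> e t != 1.
Proof.
move=> /andP[t0 t1]; rewrite eq_complex/= negb_and; apply/orP; left.
have -> : 2 * pi * t = (pi * t) *+ 2 by ring.
rewrite cos_mulr2n cos2sin2.
have : 0 < sin (pi * t).
  apply: sin_gt0_pi; rewrite mulr_gt0 ?pi_gt0//=.
  by rewrite -[ltRHS]mulr1 ltr_pM2l ?pi_gt0.
move=> /(exprn_gt0 2); move: (sin _ ^+ 2) => S S0.
by apply/negP => /eqP; lra.
Qed.

(** [acos] of the normalised real part gives the angle up to sign; the sign of the imaginary part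
    decides. *)
Lemma complex_polar z : exists s, z = (cabs z)%:C%C * e s.
Proof.
have [->|z0] := eqVneq z 0; first by exists 0; rewrite cabs0 mul0r.
have c0 : cabs z != 0 by rewrite cabs_eq0.
set w := (cabs z)^-1%:C%C * z.
have w1 : complex.Re w ^+ 2 + complex.Im w ^+ 2 = 1.
  by rewrite -sqr_cabs /w cabsM cabs_real ger0_norm ?invr_ge0 ?cabs_ge0// mulVf// expr1n.
have zw : z = (cabs z)%:C%C * w.
  by rewrite /w mulrA -rmorphM/= mulfV// mul1r.
suff [th [hc hs]] : exists th, cos th = complex.Re w /\ sin th = complex.Im w.
  exists (th / (2 * pi)); rewrite {1}zw; congr (_ * _).
  have -> : e (th / (2 * pi)) = (cos th +i* sin th)%C.
    by rewrite /e mulrCA mulfV ?mulr1// mulf_neq0 ?pnatr_eq0// gt_eqF// pi_gt0.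
  by rewrite hc hs; case: (w).
set a := complex.Re w in w1 *; set b := complex.Im w in w1 *.
have a1 : -1 <= a <= 1 by apply/andP; split; nra.
have ca : cos (acos a) = a by rewrite acosK// in_itv.
have sa : sin (acos a) = `|b|.
  by rewrite sin_acos// -w1 addrC addKr sqrtr_sqr.
have [b0|b0] := leP 0 b.
  by exists (acos a); rewrite ca sa ger0_norm.
by exists (- acos a); rewrite cosN sinN ca sa ltr0_norm// opprK.
Qed.

Lemma sqr_cabs_1De (x t : R) : cabs (1 + x%:C%C * e t) ^+ 2 = sqdist x t.
Proof.
rewrite sqr_cabs /= /sqdist /cos1 !mul0r subr0 addr0 add0r.
set c := cos _; set s := sin _.
have : c ^+ 2 + s ^+ 2 = 1 by exact: cos2Dsin2.
by move=> cs; rewrite !exprMn -[X in _ + X ^+ 2 + _]mulr1; nra.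
Qed.

(** The argument of [z] becomes a translation of [t], which means of periodic functions do not
    see. *)
Lemma cabs_1De (z : R[i]) : exists s, forall t,
  cabs (1 + z * e t) = Num.sqrt (sqdist (cabs z) (t + s)).
Proof.
have [s zs] := complex_polar z; exists s => t.
rewrite -sqr_cabs_1De sqrtr_sqr ger0_norm ?cabs_ge0// {1}zs.
by rewrite [t + s]addrC eD mulrA.
Qed.

(** Each Horner step mixes real and imaginary parts, so the induction carries both. *)
Lemma cont_horner (P : {poly R[i]}) (g : R -> R[i]) :
  continuous (fun t => complex.Re (g t)) -> continuous (fun t => complex.Im (g t)) ->
  continuous (fun t => complex.Re P.[g t]) /\ continuous (fun t => complex.Im P.[g t]).
Proof.
move=> er ei; elim/poly_ind: P => [|P a [cr ci]].
  by split; under eq_fun do rewrite horner0; exact: cont_cst.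
have E (t : R) : (P * 'X + a%:P).[g t] = P.[g t] * g t + a by rewrite hornerMXaddC.
have mulE (u v : R[i]) : complex.Re (u * v + a) =
   complex.Re u * complex.Re v + - (complex.Im u * complex.Im v) + complex.Re a /\
   complex.Im (u * v + a) =
   complex.Re u * complex.Im v + complex.Im u * complex.Re v + complex.Im a.
  by case: u v a {E} => [? ?] [? ?] [? ?].
split.
  apply: (eq_cont (fun t => etrans (congr1 _ (E t)) (mulE _ _).1)); cont.
apply: (eq_cont (fun t => etrans (congr1 _ (E t)) (mulE _ _).2)); cont.
Qed.

Lemma cont_cabs_horner (P : {poly R[i]}) (g : R -> R[i]) :
  continuous (fun t => complex.Re (g t)) -> continuous (fun t => complex.Im (g t)) ->
  continuous (fun t => cabs P.[g t]).
Proof.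
move=> er ei; have [cr ci] := cont_horner P er ei.
apply: (eq_cont (fun t => cabsE _)); apply: cont_sqrt; cont.
Qed.

Lemma cont_cabs_horner_e (P : {poly R[i]}) (c : R[i]) :
  continuous (fun t : R => cabs P.[c * e t]).
Proof. by case: c => u v; apply: cont_cabs_horner => /=; cont. Qed.

Lemma cont_cabs_horner_dilation (P : {poly R[i]}) (z : R[i]) :
  continuous (fun r : R => cabs P.[r%:C%C * z]).
Proof.
have cid : continuous (fun r : R => r) by move=> ?; exact: cvg_id.
by case: z => u v; apply: cont_cabs_horner => /=; cont.
Qed.

End ComplexModulus.

(** * Averaging over rotations by roots of unity *)

Section Averaging.
Context {R : realType}.

(** The tangent of [s^p] at [m], obtained from Young's inequality for [s] and [m^(p-1)]; [p = 1] is
    separate, having no finite conjugate exponent. *)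
Lemma powR_tangent (p s m : R) : 1 <= p -> 0 <= s -> 0 <= m ->
  p * (s * m `^ (p - 1)) - (p - 1) * m `^ p <= s `^ p.
Proof.
rewrite le_eqVlt => /predU1P[<-|p1] s0 m0.
  by rewrite subrr powRr0 mul0r subr0 mul1r mulr1 powRr1.
have p0 : 0 < p by lra.
have p10 : 0 < p - 1 by lra.
have q0 : 0 < p / (p - 1) by rewrite divr_gt0.
have pq : p^-1 + (p / (p - 1))^-1 = 1 by field; rewrite !gt_eqF.
have := conjugate_powR s0 (powR_ge0 m (p - 1)) p0 q0 pq.
rewrite -powRrM (_ : (p - 1) * (p / (p - 1)) = p); last by field; rewrite gt_eqF.
rewrite -(ler_pM2l p0) => h.
have E : p * (s `^ p / p + m `^ p / (p / (p - 1))) = s `^ p + (p - 1) * m `^ p.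
  by field; rewrite !gt_eqF.
by move: h; rewrite E; lra.
Qed.

(** Sum the tangent inequalities at the arithmetic mean [m]: the linear terms add up to [n m^p]. *)
Lemma powR_mean_le (p : R) (n : nat) (s : 'I_n -> R) : 1 <= p -> (0 < n)%N ->
  (forall i, 0 <= s i) ->
  (n%:R^-1 * \sum_i s i) `^ p <= n%:R^-1 * \sum_i s i `^ p.
Proof.
move=> p1 n0 s0; have nn0 : 0 < n%:R :> R by rewrite ltr0n.
set m := n%:R^-1 * _.
have m0 : 0 <= m by rewrite mulr_ge0 ?invr_ge0 ?sumr_ge0// ltW.
have Sm : \sum_i s i = n%:R * m by rewrite /m mulVKf// gt_eqF.
have : \sum_i (p * (s i * m `^ (p - 1)) - (p - 1) * m `^ p) <= \sum_i s i `^ p.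
  by apply: ler_sum => i _; apply: powR_tangent.
rewrite sumrB -mulr_sumr -mulr_suml Sm sumr_const card_ord -mulrA mulr_powRB1//; last lra.
move=> h; rewrite mulrC ler_pdivlMr//; apply: le_trans h.
by rewrite -mulr_natl le_eqVlt; apply/orP; left; apply/eqP; ring.
Qed.

Lemma mean_sum (I : Type) (s : seq I) (f : I -> R -> R) :
  (forall i, continuous (f i)) ->
  mean (fun t : R => \sum_(i <- s) f i t) = \sum_(i <- s) mean (f i).
Proof.
move=> cf; elim: s => [|i s IH].
  by under eq_mean do rewrite big_nil; rewrite mean_cst big_nil.
under eq_mean do rewrite big_cons.
by rewrite meanD ?IH ?big_cons//; exact: cont_sum.
Qed.

(** A geometric sum of ratio [z = e (j / N)], with [z != 1] and [z ^+ N = 1]. *)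
Lemma sum_roots_of_unity (N j : nat) : (0 < j < N)%N ->
  \sum_(m < N) e (j%:R * (m%:R / N%:R)) = 0 :> R[i].
Proof.
move=> /andP[j0 jN].
have N0 : 0 < N%:R :> R by rewrite ltr0n; lia.
have N0' : N%:R != 0 :> R by rewrite gt_eqF.
pose z : R[i] := e (j%:R / N%:R).
have z1 : z != 1.
  apply: e_neq1; rewrite divr_gt0// ?ltr0n//=.
  by rewrite ltr_pdivrMr// mul1r ltr_nat.
rewrite (eq_bigr (fun m : 'I_N => z ^+ m)); last first.
  by move=> m _; rewrite eX; congr e; field.
apply: (@mulfI _ (z - 1)); first by rewrite subr_eq0.
by rewrite -subrX1 eX mulrCA mulfV// mulr1 e_nat subrr mulr0.
Qed.

(** Averaging keeps only the exponents divisible by [N], and the size bound leaves just 0 and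
    [N]. *)
Lemma average_horner_e (N : nat) (P : {poly R[i]}) (t : R) : (0 < N)%N ->
  (size P <= N.+1)%N ->
  \sum_(m < N) P.[e (t + m%:R / N%:R)] = N%:R * (P`_0 + P`_N * e (N%:R * t)).
Proof.
move=> N0 sP; have Nn0 : N%:R != 0 :> R by rewrite pnatr_eq0 -lt0n.
under eq_bigr do rewrite (horner_coef_wide _ sP).
rewrite exchange_big/=.
have E (j : nat) : \sum_(m < N) P`_j * e (t + m%:R / N%:R) ^+ j =
    P`_j * e (j%:R * t) * \sum_(m < N) e (j%:R * (m%:R / N%:R)).
  by rewrite mulr_sumr; apply: eq_bigr => m _; rewrite eX mulrDr eD [LHS]mulrA.
under eq_bigr do rewrite E.
case: N N0 sP Nn0 E => // n _ _ Nn0 _.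
rewrite big_ord_recl [X in _ + X]big_ord_recr/= [X in _ + (X + _)]big1 ?add0r; last first.
  by move=> i _; rewrite sum_roots_of_unity ?mulr0//= /bump/= add1n ltnS ltn_ord.
under eq_bigr do rewrite mul0r e0.
rewrite /bump/= add1n.
under [X in _ + _ * X]eq_bigr do rewrite mulrCA mulfV// mulr1 e_nat.
by rewrite !sumr_const card_ord mul0r e0 mulr1 mulrDr ![_ * n.+1%:R]mulrC.
Qed.

(** Rotations preserve the mean of [h], so [h] may be replaced by its average. Pointwise, the power
    mean inequality and the triangle inequality bound that average below by the power of the modulus
    of [1 + P_N z^N]. *)
Lemma mean_horner_powR_ge (N : nat) (P : {poly R[i]}) (p : R) : (0 < N)%N ->
  (size P <= N.+1)%N -> P`_0 = 1 -> 1 <= p ->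
  mean (fun t : R => sqdist (cabs P`_N) t `^ (p / 2))
  <= mean (fun t : R => cabs P.[e t] `^ p).
Proof.
move=> N0 sP P0 p1; have p0 : 0 < p by lra.
have p20 : 0 < p / 2 by lra.
have Nn0 : N%:R != 0 :> R by rewrite pnatr_eq0 -lt0n.
have [s Hs] := cabs_1De P`_N.
set h := fun t : R => cabs P.[e t] `^ p.
have ch : continuous h.
  apply: cont_powR => // [|t]; last exact: cabs_ge0.
  have := @cont_cabs_horner_e _ P 1.
  by under eq_fun do rewrite mul1r.
have hP (t : R) : h (t + 1) = h t by rewrite /h eD e1 mulr1.
have cx := cont_sqdist_powR (cabs_ge0 P`_N) p20.
have Dper (t : R) : sqdist (cabs P`_N) (t + 1) `^ (p / 2) = sqdist (cabs P`_N) t `^ (p / 2).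
  by rewrite sqdistD1.
(* The factor [N] accounts for [z^N], the shift [s] for the argument of [P_N]. *)
rewrite -(mean_affine s cx Dper N0).
have chm (m : 'I_N) : continuous (fun t : R => h (t + m%:R / N%:R)).
  have := @cont_affine _ _ 1 (m%:R / N%:R) ch.
  by under eq_fun do rewrite mul1r.
have -> : mean h = mean (fun t : R => N%:R^-1 * \sum_(m < N) h (t + m%:R / N%:R)).
  rewrite meanZ; last exact: cont_sum.
  rewrite mean_sum//; under eq_bigr do rewrite mean_shift//.
  by rewrite sumr_const card_ord -[mean _ *+ N]mulr_natl mulKf.
apply: le_mean; [exact: cont_affine cx|by cont; exact: cont_sum|] => t.
have -> : sqdist (cabs P`_N) (N%:R * t + s) `^ (p / 2) =
    cabs (P`_0 + P`_N * e (N%:R * t)) `^ p.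
  rewrite P0 Hs [p / 2]mulrC powRrM powR12_sqrt ?powR_ge0//.
  exact: sqdist_ge0 (cabs_ge0 _).
apply: le_trans (powR_mean_le p1 N0 _); last by move=> m; exact: cabs_ge0.
apply: ge0_ler_powR; rewrite ?nnegrE ?cabs_ge0 ?(ltW p0)//.
  by rewrite mulr_ge0 ?invr_ge0 ?sumr_ge0// => m _; exact: cabs_ge0.
rewrite [leRHS]mulrC ler_pdivlMr ?ltr0n// [leLHS]mulrC.
have -> : N%:R * cabs (P`_0 + P`_N * e (N%:R * t)) =
   cabs (N%:R * (P`_0 + P`_N * e (N%:R * t))).
  rewrite cabsM -[N%:R in RHS](rmorph_nat (real_complex R)) cabs_real.
  by rewrite ger0_norm.
by rewrite -average_horner_e//; exact: cabs_sum.
Qed.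

End Averaging.

(** * Jensen's formula *)

Lemma horner_1B (K : comNzRingType) (b z : K) : (1 - b%:P * 'X).[z] = 1 - b * z.
Proof. by rewrite hornerD hornerN hornerCM hornerX -polyC1 hornerC. Qed.

Section Jensen.
Context {R : realType}.
Notation mu := (@lebesgue_measure R).

(** Monotone convergence for the nonnegative increasing functions [f 0 - f k]. The limit [L] may
    take the value [-oo]. *)
Lemma integral_decreasing_limit (f : nat -> R -> R) (L : R -> \bar R) (c : R) :
  (forall k, continuous (f k)) ->
  (forall k j t, (k <= j)%N -> f j t <= f k t) ->
  (forall t, (f k t)%:E @[k --> \oo] --> L t) ->
  mean (f k) @[k --> \oo] --> c ->
  (\int[mu]_(t in `[0%R, 1%R]) L t = c%:E)%E.
Proof.
move=> cf df fL fc; pose D := `[0%R, 1%R]%classic : set (measurableTypeR R).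
have mD : measurable D by exact: measurable_itv.
have itf k : mu.-integrable D (EFin \o f k) by exact: continuous_integrable.
have intE k : (\int[mu]_(t in D) (f k t)%:E = (mean (f k))%:E)%E.
  by rewrite /mean /Rintegral fineK//; apply: integrable_fin_num => //; exact: itf.
pose g (k : nat) (t : R) : \bar R := ((f 0%N t)%:E - (f k t)%:E)%E.
pose G (t : R) : \bar R := ((f 0%N t)%:E - L t)%E.
have gG t : g k t @[k --> \oo] --> G t.
  by apply: cvgeB => //; exact: cvg_cst.
have mg k : measurable_fun D (g k).
  by apply: emeasurable_funB; exact: (measurable_int mu (itf _)).
have g0 k t : (0 <= g k t)%E by rewrite /g -EFinB lee_fin subr_ge0 df.
have gnd t : nondecreasing_seq (g ^~ t).
  by move=> k j kj; rewrite /g -!EFinB lee_fin lerB// df.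
have mG : measurable_fun D G by apply: emeasurable_fun_cvg mg _ => t _; exact: gG.
have G0 t : (0 <= G t)%E.
  rewrite -(cvg_lim _ (gG t))//; apply: lime_ge; last exact: nearW.
  by apply/cvg_ex; exists (G t); exact: gG.
have intG : (\int[mu]_(t in D) G t = (mean (f 0%N) - c)%:E)%E.
  transitivity (\int[mu]_(t in D) limn (g ^~ t))%E.
    by apply: eq_integral => t _; rewrite (cvg_lim _ (gG t)).
  rewrite monotone_convergence//.
  apply/cvg_lim => //.
  have -> : (fun k => \int[mu]_(t in D) g k t)%E = EFin \o (fun k => mean (f 0%N) - mean (f k)).
    apply/funext => k; rewrite /g integralB//; try exact: itf.
    by rewrite !intE -EFinB.
  apply: cvg_EFin; first exact: nearW.
  by apply: cvgB; [exact: cvg_cst|exact: fc].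
have iG : mu.-integrable D G.
  apply/integrableP; split => //.
  under eq_integral do rewrite gee0_abs//.
  by rewrite intG ltry.
transitivity (\int[mu]_(t in D) ((EFin \o f 0%N) \- G) t)%E.
  apply: eq_integral => t _; rewrite /G/=.
  (* Otherwise [G t] would be [-oo], against [G0]; this makes the subtraction reversible. *)
  have : L t != +oo%E.
    have := G0 t; rewrite /G; case: (L t) => //=.
  case: (L t) => [r||]//= _.
  by rewrite -!EFinB opprB addrC subrK.
rewrite (integralB mD (itf 0%N) iG).
by rewrite intE intG -EFinB opprB addrC subrK.
Qed.

Lemma cabs_1B_gt0 (z : R[i]) : cabs z < 1 -> 0 < cabs (1 - z).
Proof.
move=> z1; rewrite lt_neqAle eq_sym cabs_eq0 cabs_ge0 andbT subr_eq0.
by apply: contraTneq z1 => <-; rewrite cabs1 ltxx.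
Qed.

Lemma mean_ln_cabs_1B (z : R[i]) : cabs z < 1 ->
  mean (fun t : R => ln (cabs (1 - z * e t))) = 0.
Proof.
move=> z1; have [s Hs] := cabs_1De (- z).
have z01 : 0 <= cabs z < 1 by rewrite cabs_ge0.
have cl : continuous (fun t : R => ln (sqdist (cabs z) t)).
  by apply: cont_ln (@cont_sqdist _ _) _ => t; exact: sqdist_gt0.
rewrite (@eq_mean _ _ (fun t => 2^-1 * ln (sqdist (cabs z) (t + s)))); last first.
  move=> t; rewrite -mulNr Hs cabsN.
  by rewrite -powR12_sqrt ?ln_powR// sqdist_ge0// cabs_ge0.
rewrite meanZ; last first.
  have := @cont_affine _ _ 1 s cl.
  by under eq_fun do rewrite mul1r.
rewrite (@mean_shift _ (fun t => ln (sqdist (cabs z) t)))//.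
  by rewrite mean_ln_sqdist// mulr0.
by move=> t; rewrite sqdistD1.
Qed.

(** The squared modulus of [1 - r w] divided by [r] decreases in [r]: after cross-multiplying, the
    difference is [(r' - r) (1 - r r' k^2)], with [k] the modulus of [w]. The term [2^-1 * ln r] is
    there to secure this monotonicity. *)
Lemma ln_cabs_dilation_antitone (w : R[i]) (r r' : R) : cabs w <= 1 ->
  0 < r -> r <= r' -> r' < 1 ->
  ln (cabs (1 - r'%:C%C * w)) - 2^-1 * ln r' <= ln (cabs (1 - r%:C%C * w)) - 2^-1 * ln r.
Proof.
move=> w1 r0 rr' r'1; have r'0 : 0 < r' by apply: lt_le_trans rr'.
have pos s : 0 < s -> s < 1 -> 0 < cabs (1 - s%:C%C * w).
  move=> s0 s1; apply: cabs_1B_gt0; rewrite cabsM cabs_real ger0_norm ?(ltW s0)//.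
  by apply: le_lt_trans s1; rewrite ler_piMr// ltW.
have c'0 := pos _ r'0 r'1; have c0 := pos _ r0 (le_lt_trans rr' r'1).
suff : ln (cabs (1 - r'%:C%C * w) ^+ 2 * r) <= ln (cabs (1 - r%:C%C * w) ^+ 2 * r').
  rewrite !lnM ?posrE ?exprn_gt0//; lra.
rewrite ler_ln ?posrE ?mulr_gt0 ?exprn_gt0//.
have wk := sqr_cabs w; have w0 := cabs_ge0 w; rewrite !sqr_cabs.
move: (cabs w) w1 wk w0 {pos c'0 c0} => k k1; case: w => a b /= kab k0.
rewrite !mul0r !subr0 !addr0 !add0r.
have kk : a ^+ 2 + b ^+ 2 <= 1 by rewrite -kab expr_le1.
have rr1 : 0 <= 1 - r * r' * (a ^+ 2 + b ^+ 2).
  rewrite subr_ge0 !mulr_ile1 ?mulr_ge0 ?addr_ge0 ?sqr_ge0 ?(ltW r0) ?(ltW r'0) ?(ltW r'1)//.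
  by rewrite ltW// (le_lt_trans rr').
have : 0 <= (r' - r) * (1 - r * r' * (a ^+ 2 + b ^+ 2)) by rewrite mulr_ge0// subr_ge0.
lra.
Qed.

(** A factor may vanish on the circle when its [beta n] has modulus 1. On circles of radius
    [r k < 1] each logarithmic mean is 0, and the correction in [ln (r k)] makes the approximations
    decrease to the integrand. *)
Lemma integral_lne_prod (N : nat) (beta : 'I_N -> R[i]) (M : R) : 0 < M ->
  (forall n, cabs (beta n) <= 1) ->
  (\int[mu]_(t in `[0%R, 1%R])
     lne (M * cabs (\prod_(n < N) (1 - beta n * e t)))%:E = (ln M)%:E)%E.
Proof.
(* An increasing sequence in [(0, 1)] with limit 1 and [ln (r k) = - 1 / (k + 2)]. *)
move=> M0 b1; pose r k : R := expR (- harmonic k.+1).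
have r0 k : 0 < r k by exact: expR_gt0.
have r1 k : r k < 1 by rewrite /r -[ltRHS]expR0 ltr_expR oppr_lt0 invr_gt0.
have rmono k j : (k <= j)%N -> r k <= r j.
  by move=> kj; rewrite /r ler_expR lerN2 lef_pV2 ?posrE// ler_nat.
have hlim : harmonic k.+1 @[k --> \oo] --> (0 : R).
  by rewrite cvg_shiftS; exact: cvg_harmonic.
have rlim : r k @[k --> \oo] --> (1 : R).
  have h0 : - harmonic k.+1 @[k --> \oo] --> (0 : R).
    by rewrite -[X in _ --> X]oppr0; apply: cvgN.
  have := @cvg_comp _ _ _ (fun k => - harmonic k.+1) (@expR R) _ _ _ h0 (@continuous_expR R 0).
  by rewrite expR0.
pose u (s : R) (t : R) := cabs (\prod_(n < N) (1 - s%:C%C * (beta n * e t))).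
pose f k t := ln (u (r k) t) - N%:R * (2^-1 * ln (r k)).
have fac0 k n t : 0 < cabs (1 - (r k)%:C%C * (beta n * e t)).
  apply: cabs_1B_gt0; rewrite !cabsM cabs_e mulr1 cabs_real ger0_norm ?(ltW (r0 k))//.
  by apply: le_lt_trans (r1 k); rewrite ler_piMr// ltW.
have lnu k t : ln (u (r k) t) = \sum_(n < N) ln (cabs (1 - (r k)%:C%C * (beta n * e t))).
  rewrite /u cabs_prod; elim: (index_enum _) => [|n s IH].
    by rewrite !big_nil ln1.
  by rewrite !big_cons lnM ?IH ?posrE ?prodr_gt0.
have u0 k t : 0 < u (r k) t by rewrite /u cabs_prod prodr_gt0.
pose P := \prod_(n < N) (1 - (beta n)%:P * 'X).
have uP s t : u s t = cabs P.[s%:C%C * e t].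
  rewrite /u /P horner_prod; congr cabs; apply: eq_bigr => n _.
  by rewrite horner_1B mulrCA.
have cu k : continuous (u (r k)).
  by apply: (eq_cont (uP (r k))); exact: cont_cabs_horner_e.
have clu k : continuous (fun t => ln (u (r k) t)) by apply: cont_ln.
have cf k : continuous (f k) by rewrite /f; cont.
have mf k : mean (f k) = N%:R * (2^-1 * harmonic k.+1).
  rewrite /f meanB; [|by cont..].
  rewrite mean_cst (eq_mean (lnu k)) mean_sum; last first.
    move=> n; have := @cont_cabs_horner_e R (1 - ((r k)%:C%C * beta n)%:P * 'X) 1.
    move=> /(@cont_ln R) H; apply: eq_cont (H _) => t.
      by rewrite horner_1B mulrA mul1r.
    by rewrite horner_1B mul1r -mulrA; exact: fac0.
  rewrite big1 => [|n _].
    by rewrite sub0r /r expRK !mulrN opprK.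
  rewrite -[RHS](@mean_ln_cabs_1B ((r k)%:C%C * beta n)).
    by apply: eq_mean => t; rewrite mulrA.
  rewrite cabsM cabs_real ger0_norm ?(ltW (r0 k))//.
  by apply: le_lt_trans (r1 k); rewrite ler_piMr// ltW.
have fE k t : f k t =
    \sum_(n < N) (ln (cabs (1 - (r k)%:C%C * (beta n * e t))) - 2^-1 * ln (r k)).
  by rewrite /f lnu sumrB sumr_const card_ord; congr (_ - _); exact: mulr_natl.
have hl : N%:R * (2^-1 * harmonic k.+1) @[k --> \oo] --> (0 : R).
  have : N%:R * (2^-1 * harmonic k.+1) @[k --> \oo] --> (N%:R * (2^-1 * 0) : R).
    by do 2 (apply: cvgM; first exact: cvg_cst).
  by rewrite !mulr0.
have lnr k : ln (r k) = - harmonic k.+1 by rewrite expRK.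
apply: (@integral_decreasing_limit (fun k t => ln M + f k t)) => //.
- by move=> k; apply: cont_add; [exact: cont_cst|exact: cf].
- move=> k j t kj; rewrite lerD2l !fE; apply: ler_sum => n _.
  apply: ln_cabs_dilation_antitone => //; last exact: rmono.
  by rewrite cabsM cabs_e mulr1.
- move=> t.
  have rc : u (r k) t @[k --> \oo] --> u 1 t.
    have cP : continuous (fun s => u s t).
      apply: (eq_cont (fun s => uP s t)); exact: cont_cabs_horner_dilation.
    exact: (@cvg_comp _ _ _ r (fun s => u s t) _ _ _ rlim (cP 1)).
  have -> : cabs (\prod_(n < N) (1 - beta n * e t)) = u 1 t.
    by rewrite /u; under [in RHS]eq_bigr do rewrite mul1r.
  have : 0 <= u 1 t by exact: cabs_ge0.
  rewrite le_eqVlt => /predU1P[u10|u10].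
    rewrite -u10 mulr0 le0_lneNy//; apply/cvgeNyPle => A.
    (* At a zero the limit is [-oo]: this threshold absorbs [ln M] and the correction, which is at
       most [N]. *)
    have eA : 0 < expR (A - N%:R - ln M) by exact: expR_gt0.
    have /cvgrPdist_lt /(_ _ eA) := rc.
    rewrite -u10; apply: filterS => k; rewrite sub0r normrN ger0_norm ?(ltW (u0 _ _))// => uk.
    rewrite lee_fin /f lnr.
    have : ln (u (r k) t) <= A - N%:R - ln M.
      by rewrite -[leRHS]expRK ler_ln ?posrE// ltW.
    have : N%:R * (2^-1 * harmonic k.+1) <= N%:R :> R.
      rewrite ler_piMr// mulr_ile1// ?invr_ge0// ?invf_le1// ?ler1n// ltr0n//.
    by rewrite !mulrN opprK; lra.
  rewrite lne_EFin ?mulr_gt0// lnM//; apply: cvg_EFin; first exact: nearW.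
  rewrite -[ln (u 1 t)]addr0; apply: cvgD; first exact: cvg_cst.
  have fE2 : f ^~ t = fun k => ln (u (r k) t) + N%:R * (2^-1 * harmonic k.+1).
    by apply/funext => k; rewrite /f lnr !mulrN opprK.
  rewrite /comp/= fE2; apply: cvgD; last exact: hl.
  by apply: continuous_cvg => //; exact: continuous_ln.
- under eq_fun do rewrite (meanD (@cont_cst R (ln M)) (cf _)) mean_cst mf.
  have : ln M + N%:R * (2^-1 * harmonic k.+1) @[k --> \oo] --> (ln M + 0 : R).
    by apply: cvgD; [exact: cvg_cst|exact: hl].
  by rewrite addr0.
Qed.

End Jensen.

(** * Reflection of roots in the unit circle *)

Section Reflection.
Context {R : realType}.

(** Chosen so that [1 - reflect a * z] is 1 at [z = 0], has no zero in the open disc, and is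
    proportional in modulus to [z - a] on the circle. *)
Definition reflect (a : R[i]) : R[i] := if cabs a <= 1 then conjc a else a^-1.

Lemma cabs_reflect_le1 a : cabs (reflect a) <= 1.
Proof.
rewrite /reflect; case: (leP (cabs a) 1) => a1; first by rewrite cabs_conj.
by rewrite cabsV invf_le1 ?ltW// (lt_trans ltr01).
Qed.

Lemma cabs_reflect a : Num.max 1 (cabs a) * cabs (reflect a) = Num.min 1 (cabs a).
Proof.
rewrite /reflect; case: (leP (cabs a) 1) => a1.
  by rewrite cabs_conj mul1r.
by rewrite cabsV mulfV// gt_eqF// (lt_trans ltr01).
Qed.

(** Inside the disc, conjugate and multiply by [e t], which has modulus 1; outside, factor out
    [- a]. *)
Lemma cabs_eB a t : cabs (e t - a) = Num.max 1 (cabs a) * cabs (1 - reflect a * e t).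
Proof.
rewrite /reflect; case: (leP (cabs a) 1) => a1.
  have conjB (z w : R[i]) : conjc (z - w) = conjc z - conjc w by rewrite rmorphB.
  have -> : cabs (e t - a) = cabs (e t * conjc (e t - a)).
    by rewrite cabsM cabs_e mul1r cabs_conj.
  by rewrite conjB mulrBr -eN -eD subrr e0 mul1r [e t * _]mulrC.
have a0 : a != 0 by rewrite -cabs_eq0 gt_eqF// (lt_trans ltr01).
by rewrite -cabsM mulrBr mulr1 mulVKf// -[LHS]cabsN opprB.
Qed.

(** Only an upper bound on the size holds, since some [b i] may be 0; the coefficient formula
    remains valid then. *)
Lemma coef_prod_1B (I : Type) (s : seq I) (b : I -> R[i]) :
  (size (\prod_(i <- s) (1 - (b i)%:P * 'X))%R <= (size s).+1)%N /\
  (\prod_(i <- s) (1 - (b i)%:P * 'X))`_(size s) = \prod_(i <- s) - b i.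
Proof.
elim: s => [|i s [IHs IHc]]; first by rewrite !big_nil size_poly1 coef1.
rewrite !big_cons mulrBl mul1r -mulrA; set Q := \prod_(i <- s) _ in IHs IHc *.
have sQ : (size ((b i)%:P * ('X * Q))%R <= (size s).+2)%N.
  rewrite mul_polyC (leq_trans (size_scale_leq _ _))//.
  by rewrite mulrC (leq_trans (size_mul_leq _ _))// size_polyX addn2.
split; first by rewrite (leq_trans (size_polyD _ _))// size_polyN geq_max sQ (leq_trans IHs).
by rewrite coefB coefCM coefXM/= IHc (nth_default _ IHs) sub0r mulNr.
Qed.

Lemma powR_prod (p : R) (I : Type) (s : seq I) (f : I -> R) :
  (forall i, 0 <= f i) -> \prod_(i <- s) f i `^ p = (\prod_(i <- s) f i) `^ p.
Proof.
move=> f0; elim: s => [|i s IH]; first by rewrite !big_nil powR1.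
by rewrite !big_cons IH powRM// prodr_ge0.
Qed.

Lemma maxr1_powR (p x : R) : 0 < p -> 0 <= x ->
  Num.max 1 (x `^ p) = Num.max 1 x `^ p.
Proof.
move=> p0 x0; have h := ge0_ler_powR (ltW p0); case: (leP x 1) => x1.
  have : x `^ p <= 1 `^ p by apply: h; rewrite ?nnegrE.
  by rewrite powR1 => xp1; rewrite max_l.
have : 1 `^ p <= x `^ p by apply: h; rewrite ?nnegrE// ltW.
by rewrite powR1 => xp1; rewrite max_r.
Qed.

Lemma minr1_powR (p x : R) : 0 < p -> 0 <= x ->
  Num.min 1 (x `^ p) = Num.min 1 x `^ p.
Proof.
move=> p0 x0; have h := ge0_ler_powR (ltW p0); case: (leP x 1) => x1.
  have : x `^ p <= 1 `^ p by apply: h; rewrite ?nnegrE.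
  by rewrite powR1 => xp1; rewrite min_r.
have : 1 `^ p <= x `^ p by apply: h; rewrite ?nnegrE// ltW.
by rewrite powR1 => xp1; rewrite min_l.
Qed.

(** On the circle [1 - z] and [1 + z] differ by a rotation of [z], so their power means agree. *)
Lemma BE (p : R) : 0 < p ->
  B p = (2^-1 * mean (fun t : R => sqdist 1 t `^ (p / 2))) `^ p^-1.
Proof.
move=> p0; have p20 : 0 < p / 2 by rewrite divr_gt0.
have [s] := @cabs_1De R (-1); rewrite cabsN cabs1 => Hs.
have <- : mean (fun t : R => cabs (1 - e t) `^ p) =
    mean (fun t : R => sqdist 1 t `^ (p / 2)).
  rewrite -(@mean_shift _ (fun t => sqdist 1 t `^ (p / 2)) s).
  - apply: eq_mean => t; rewrite -mulN1r Hs [p / 2]mulrC powRrM powR12_sqrt//.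
    exact: sqdist_ge0.
  - exact: cont_sqdist_powR.
  - by move=> t; rewrite sqdistD1.
by [].
Qed.

End Reflection.

Theorem theorem1 (R : realType) (N : nat) (F : {poly R[i]})
    (alpha : 'I_N -> R[i]) (p : R) :
  (1 <= N)%N ->
  size F = N.+1 ->
  F = F`_N *: \prod_(n < N) ('X - (alpha n)%:P) ->
  (1 <= p <= 2 ->
     pnorm p F >=
     B p * cabs F`_N *
       (\prod_(n < N) Num.max 1 (cabs (alpha n) `^ p)
        + \prod_(n < N) Num.min 1 (cabs (alpha n) `^ p)) `^ p^-1) /\
  (1 <= p ->
     pnorm p F >=
     mahler F *
       (1 + p ^+ 2 * cabs (F`_0 * F`_N) ^+ 2 / (4 * mahler F ^+ 4)) `^ p^-1).
Proof.
move=> N1 sF FE; set a := F`_N.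
have a0 : 0 < cabs a.
  rewrite lt_neqAle eq_sym cabs_eq0 cabs_ge0 andbT.
  by rewrite /a -[N]/(N.+1.-1) -sF -lead_coefE lead_coef_eq0 -size_poly_eq0 sF.
pose beta n := reflect (alpha n).
pose P := \prod_(n < N) (1 - (beta n)%:P * 'X).
pose mx := \prod_(n < N) Num.max 1 (cabs (alpha n)).
pose x := cabs P`_N.
pose M := cabs a * mx.
have sz : size (index_enum 'I_N) = N by rewrite -[RHS]card_ord cardT enumT.
have [sP PN] : (size P <= N.+1)%N /\ P`_N = \prod_(n < N) - beta n.
  by have := coef_prod_1B (index_enum 'I_N) beta; rewrite sz.
have P0 : P`_0 = 1.
  rewrite -horner_coef0 horner_prod big1// => n _.
  by rewrite horner_1B mulr0 subr0.
have hP t : P.[e t] = \prod_(n < N) (1 - beta n * e t).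
  by rewrite horner_prod; apply: eq_bigr => n _; rewrite horner_1B.
have mx1 : 1 <= mx.
  by rewrite /mx; elim/big_ind: _ => // [u v u1 v1|n _]; [rewrite -[1]mulr1 ler_pM|rewrite le_max lexx].
have M0 : 0 < M by rewrite mulr_gt0// (lt_le_trans _ mx1).
have mnx : \prod_(n < N) Num.min 1 (cabs (alpha n)) = mx * x.
  rewrite /x PN cabs_prod -big_split/=; apply: eq_bigr => n _.
  by rewrite cabsN cabs_reflect.
have x01 : 0 <= x <= 1.
  rewrite cabs_ge0/= /x PN cabs_prod; apply: prodr_ile1 => n _.
  by rewrite cabs_ge0 cabsN cabs_reflect_le1.
have x0 : 0 <= x by case/andP: x01.
have FP t : cabs F.[e t] = M * cabs P.[e t].
  rewrite FE hornerZ cabsM -/a -mulrA; congr (_ * _).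
  rewrite horner_prod hP !cabs_prod -big_split/=; apply: eq_bigr => n _.
  by rewrite hornerXsubC cabs_eB.
have mahlerE : mahler F = M.
  rewrite /mahler.
  have -> : (\int[lebesgue_measure]_(t in `[0%R, 1%R]) lne (cabs F.[e t])%:E = (ln M)%:E)%E.
    rewrite -(@integral_lne_prod R N beta M M0) => [|n]; last exact: cabs_reflect_le1.
    by apply: eq_integral => t _; rewrite FP hP.
  by rewrite /= lnK.
have F0N : cabs (F`_0 * F`_N) = M ^+ 2 * x.
  rewrite cabsM -/a -horner_coef0 FE hornerZ -/a horner_prod cabsM cabs_prod.
  (* Each modulus is [max 1] times [min 1] of itself. *)
  have -> : \prod_(n < N) cabs ('X - (alpha n)%:P).[0] = mx * (mx * x).
    rewrite -mnx /mx -big_split/=; apply: eq_bigr => n _.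
    rewrite hornerXsubC sub0r cabsN.
    by case: (leP (cabs (alpha n)) 1) => _; rewrite ?mul1r ?mulr1.
  by rewrite /M; ring.
pose I := mean (fun t : R => cabs P.[e t] `^ p).
have pnormE : 1 <= p -> pnorm p F = M * I `^ p^-1.
  move=> p1; have p0 : 0 < p by lra.
  have -> : pnorm p F = mean (fun t : R => cabs F.[e t] `^ p) `^ p^-1 by [].
  have -> : mean (fun t => cabs F.[e t] `^ p) = M `^ p * I.
    rewrite -meanZ; last first.
      apply: cont_powR => // [|t]; last exact: cabs_ge0.
      have := @cont_cabs_horner_e R P 1.
      by under eq_fun do rewrite mul1r.
    by apply: eq_mean => t; rewrite FP powRM ?cabs_ge0// ltW.
  rewrite powRM ?powR_ge0//; last by apply: mean_ge0 => t; exact: powR_ge0.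
  by rewrite -powRrM mulfV ?powRr1 ?(ltW M0)// gt_eqF.
have low : 1 <= p -> mean (fun t : R => sqdist x t `^ (p / 2)) <= I.
  by move=> p1; apply: mean_horner_powR_ge.
(* Both bounds now reduce to a lower bound [u] for [I]. *)
have mono u : 1 <= p -> 0 <= u -> u <= I -> M * u `^ p^-1 <= pnorm p F.
  move=> p1 u0 uI; rewrite (pnormE p1) ler_pM2l//.
  have I0 : 0 <= I by apply: le_trans uI.
  have p0 : 0 <= p by apply: le_trans p1.
  by apply: ge0_ler_powR; rewrite ?nnegrE ?invr_ge0.
split=> [/andP[p1 p2]|p1].
  have p0 : 0 < p by lra.
  under eq_bigr do rewrite maxr1_powR ?cabs_ge0//.
  under [X in _ + X]eq_bigr do rewrite minr1_powR ?cabs_ge0//.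
  rewrite !powR_prod ?mnx; last 2 first.
  - by move=> n; rewrite le_min ler01 cabs_ge0.
  - by move=> n; rewrite le_max ler01.
  have mx0 : 0 <= mx by apply: le_trans mx1.
  have xp0 : 0 <= 1 + x `^ p by rewrite addr_ge0// powR_ge0.
  have -> : mx `^ p + (mx * x) `^ p = mx `^ p * (1 + x `^ p).
    by rewrite (powRM _ mx0 x0) mulrDr mulr1.
  rewrite (powRM _ (powR_ge0 _ _) xp0) -powRrM mulfV ?gt_eqF// powRr1//.
  rewrite (BE p0).
  set phi1 := mean _.
  have phi10 : 0 <= phi1 by apply: mean_ge0 => t; exact: powR_ge0.
  have := mono ((1 + x `^ p) / 2 * phi1) p1.
  (* Groups [2^-1 * phi1], which is the [p]-th power of [B p]. *)
  have -> : (1 + x `^ p) / 2 * phi1 = (2^-1 * phi1) * (1 + x `^ p) by ring.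
  rewrite powRM//; last by rewrite mulr_ge0.
  have -> k l : M * (k * l) = k * cabs a * (mx * l) by rewrite /M; ring.
  apply; first by rewrite mulr_ge0// mulr_ge0.
  apply: le_trans (low p1).
  have p21 : 0 < p / 2 <= 1 by apply/andP; split; lra.
  have pp : 2 * (p / 2) = p by lra.
  have := mean_sqdist_powR_ge_pair x01 p21; rewrite pp.
  by rewrite -/phi1 => h; apply: le_trans h; rewrite le_eqVlt; apply/orP; left; apply/eqP; ring.
rewrite mahlerE F0N.
(* The powers of [M] cancel, leaving the power mean bound with [q = p / 2]. *)
have -> : 1 + p ^+ 2 * (M ^+ 2 * x) ^+ 2 / (4 * M ^+ 4) = 1 + (p / 2) ^+ 2 * x ^+ 2.
  by field; rewrite gt_eqF.
apply: mono => //; first by rewrite addr_ge0// mulr_ge0 ?sqr_ge0.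
by apply: le_trans (low p1); apply: mean_sqdist_powR_ge => //; lra.
Qed.
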